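(* There exists a planar graph $G$ with obstacle number $\mathrm{obs}(G)$ greater than $1$.
   Context: All graphs are finite, simple, and undirected. A straight-line drawing of a graph $G$ in the plane places the vertices at distinct points of $\mathbb{R}^2$ and draws each edge as the closed line segment joining its endpoints; the drawing is regarded as the union of all vertex points and edge segments (edges are allowed to cross). A non-edge of $G$ is a pair of distinct vertices $a,b$ such that $ab$ is not an edge of $G$; in a drawing it is identified with the line segment joining $a$ and $b$. An obstacle representation of $G$ is a straight-line drawing of $G$ in the plane together with a collection of connected subsets of the plane, called obstacles, such that no obstacle meets the drawing of $G$, while every non-edge of $G$ intersects at least one obstacle. The obstacle number $\mathrm{obs}(G)$ is the least number of obstacles in an obstacle representation of $G$. *)

(* Defs.v *)
From HB Require Import structures.
From mathcomp Require Import all_boot all_order all_algebra.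
From mathcomp Require Import all_classical all_reals all_analysis.

Set Implicit Arguments.
Unset Strict Implicit.
Unset Printing Implicit Defensive.

Import Order.TTheory GRing.Theory Num.Theory.
Import numFieldNormedType.Exports.

Local Open Scope classical_set_scope.
Local Open Scope ring_scope.

Record sgraph := SGraph {
  vertex :> finType;
  edge : rel vertex;
  edge_sym : symmetric edge;
  edge_irrefl : irreflexive edge }.

Arguments edge {G} _ _ : rename.

Definition nonedge (G : sgraph) (a b : G) : bool := (a != b) && ~~ edge a b.

(* The plane is R * R, with its product topology. *)
Definition segment (R : realType) (a b : R * R) : set (R * R) :=
  [set (1 - t) *: a + t *: b | t in `[0, 1]].

(* A planar drawing: the edge uv is the Jordan arc arc u v, traversed from u to
   v. The second clause says that arc v u is the same curve, reversed, so each
   undirected edge is drawn once. *)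
Definition planar_drawing (R : realType) (G : sgraph)
    (pos : G -> R * R) (arc : G -> G -> R -> R * R) : Prop :=
  [/\ injective pos,
      forall u v, edge u v -> forall t, t \in `[0, 1] ->
        arc v u t = arc u v (1 - t),
      forall u v, edge u v ->
        [/\ {within `[0, 1], continuous (arc u v)},
            {in `[0, 1] &, injective (arc u v)},
            arc u v 0 = pos u & arc u v 1 = pos v],
      forall u v w, edge u v -> forall t, t \in `]0, 1[ ->
        arc u v t <> pos w &
      forall u v x y, edge u v -> edge x y -> [set u; v] <> [set x; y] ->
        forall s t, s \in `]0, 1[ -> t \in `]0, 1[ -> arc u v s <> arc x y t].

Definition planar (R : realType) (G : sgraph) : Prop :=
  exists (pos : G -> R * R) (arc : G -> G -> R -> R * R),
    planar_drawing pos arc.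

Definition drawing (R : realType) (G : sgraph) (pos : G -> R * R) :
    set (R * R) :=
  [set z | (exists v, z = pos v) \/
           (exists u v, edge u v /\ segment (pos u) (pos v) z)].

Definition obstacle_representation (R : realType) (G : sgraph)
    (pos : G -> R * R) (k : nat) (obstacle : 'I_k -> set (R * R)) : Prop :=
  [/\ injective pos,
      forall i, connected (obstacle i),
      forall i, obstacle i `&` drawing pos = set0 &
      forall a b, nonedge a b ->
        exists i, segment (pos a) (pos b) `&` obstacle i !=set0].

Definition has_obstacle_representation (R : realType) (G : sgraph) (k : nat) :
    Prop :=
  exists (pos : G -> R * R) (obstacle : 'I_k -> set (R * R)),
    obstacle_representation pos obstacle.

(* The least k, with the junk value 0 if there were no representation; hence a
   positive obs is a least number that is attained. *)
Definition obs (R : realType) (G : sgraph) : nat :=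
  xget 0%N [set k | has_obstacle_representation R G k /\
    forall j, has_obstacle_representation R G j -> (k <= j)%N].

(* Main.v *)
Require Import Defs.
From mathcomp Require Import all_boot all_order all_algebra.
From mathcomp Require Import all_classical all_reals all_analysis.
From mathcomp Require Import ring lra.
Set Implicit Arguments.
Unset Strict Implicit.
Unset Printing Implicit Defensive.

Import Order.TTheory GRing.Theory Num.Theory.
Import numFieldNormedType.Exports.
Local Open Scope classical_set_scope.
Local Open Scope ring_scope.

(* Let H be the octahedron with the four faces at one vertex stacked, and let G be two
   disjoint copies of H, drawn with a single obstacle O. As the obstacle can be fattened,
   the vertices may be moved into general position. Call a triangle framed by a copy if
   its sides lie on edges of that copy. If O meets a framed triangle of one copy, it lies
   in its interior, and so does every vertex P of the other copy: otherwise some nonedge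
   from the first copy to P would miss the interior. This cannot happen for both copies
   at once, so O is outside all framed triangles of one copy of H. Then no nonedge of
   this copy is covered by one or two framed triangles, which restricts the orientations
   of the triples of its ten vertices. Together with the axioms of orientations in the
   plane, these restrictions are contradictory. *)

(** * Orientations, segments and triangles *)

(** Twice the signed area of the triangle: positive when [a], [b], [c] turn left, zero when they are
    collinear. *)
Definition det (R : pzRingType) (a b c : R * R) : R :=
  (b.1 - a.1) * (c.2 - a.2) - (b.2 - a.2) * (c.1 - a.1).

Definition lerp (R : pzRingType) (a b : R * R) (t : R) : R * R :=
  ((1 - t) * a.1 + t * b.1, (1 - t) * a.2 + t * b.2).

Section Plane.
Variable R : realType.
Implicit Types (a b c d x y z A B C : R * R) (s t u v : R).

Lemma det_rot a b c : det b c a = det a b c.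
Proof. by rewrite /det; ring. Qed.

Lemma det_swap a b c : det b a c = - det a b c.
Proof. by rewrite /det; ring. Qed.

Lemma det_aa a b : det a b a = 0.
Proof. by rewrite /det; ring. Qed.

Lemma det_bb a b : det a b b = 0.
Proof. by rewrite /det; ring. Qed.

Lemma det_lerp a b c d t :
  det a b (lerp c d t) = (1 - t) * det a b c + t * det a b d.
Proof. by rewrite /det /=; ring. Qed.

(** The three-term Grassmann-Plücker relation, from which the [fan] clauses follow. *)
Lemma det_plucker a b c d e :
  det a b d * det a c e = det a b c * det a d e + det a b e * det a c d :> R.
Proof. by rewrite /det; ring. Qed.

Lemma segmentP a b z :
  segment a b z <-> exists t, [/\ 0 <= t, t <= 1 & z = lerp a b t].
Proof.
split=> -[t].
  by rewrite /= in_itv /= => /andP[t0 t1] <-; exists t.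
by move=> [t0 t1 ->]; exists t => //=; rewrite in_itv /= t0.
Qed.

Lemma segment_lerp a b t : 0 <= t -> t <= 1 -> segment a b (lerp a b t).
Proof. by move=> t0 t1; apply/segmentP; exists t. Qed.

Lemma segment_sym a b : segment a b `<=` segment b a.
Proof.
move=> z /segmentP[t [t0 t1 ->]]; apply/segmentP; exists (1 - t).
by split; [lra | lra | congr pair => /=; ring].
Qed.

Lemma segmentl a b : segment a b a.
Proof.
by apply/segmentP; exists 0; split=> //; case: a => ? ?; congr pair => /=; ring.
Qed.

Lemma segmentr a b : segment a b b.
Proof. exact/segment_sym/segmentl. Qed.

Lemma segments_meet a b c d :
  det a b c * det a b d < 0 -> det c d a * det c d b < 0 ->
  exists2 z, segment a b z & segment c d z.
Proof.
move=> H1 H2.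
(* Along [a b] the function [det c d] is affine and [t] is its zero; [s] is the zero of [det a b]
   along [c d]. *)
pose t := det c d a / (det c d a - det c d b).
pose s := det a b c / (det a b c - det a b d).
have n1 : det c d a - det c d b != 0 by apply/eqP => e; nra.
have n2 : det a b c - det a b d != 0 by apply/eqP => e; nra.
have unit_ratio (p q : R) : p * q < 0 -> 0 <= p / (p - q) <= 1.
  move=> pq; have [p0|p0] := leP 0 p.
    have q0 : q < 0 by nra.
    by rewrite divr_ge0 ?ler_pdivrMr /=; lra.
  have q0 : 0 < q by nra.
  rewrite -(opprK p) -(opprK q) -opprD invrN mulrNN divr_ge0 ?ler_pdivrMr /=; lra.
have /andP[t0 t1] := unit_ratio _ _ H2; have /andP[s0 s1] := unit_ratio _ _ H1.
exists (lerp a b t); first exact: segment_lerp.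
suff -> : lerp a b t = lerp c d s by exact: segment_lerp.
by rewrite /t /s; congr pair => /=; rewrite /det in n1 n2 *; field; apply/andP.
Qed.

(* The factor [det A B C] makes this the closed triangle for either orientation of
   the corners; for collinear corners it is the whole plane. *)
Definition tri A B C z := [/\ 0 <= det A B C * det A B z,
  0 <= det A B C * det B C z & 0 <= det A B C * det C A z].

Definition tri_int A B C z := [/\ 0 < det A B C * det A B z,
  0 < det A B C * det B C z & 0 < det A B C * det C A z].

Lemma tri_rot A B C z : tri A B C z -> tri B C A z.
Proof. by case=> h1 h2 h3; split; rewrite det_rot. Qed.

Lemma det_split A B C z : det A B C = det A B z + det B C z + det C A z :> R.
Proof. by rewrite /det; ring. Qed.

Lemma det_barycentric1 A B C z :
  det A B C * z.1 = det B C z * A.1 + det C A z * B.1 + det A B z * C.1 :> R.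
Proof. by rewrite /det; ring. Qed.

Lemma det_barycentric2 A B C z :
  det A B C * z.2 = det B C z * A.2 + det C A z * B.2 + det A B z * C.2 :> R.
Proof. by rewrite /det; ring. Qed.

(** Divided by [det A B C], the three determinants are the barycentric coordinates of [z]. When the
    one belonging to [C] vanishes, [z] is a convex combination of [A] and [B]. *)
Lemma tri_side A B C z :
  det A B C != 0 -> tri A B C z -> det A B z = 0 -> segment A B z.
Proof.
move=> n [_ h2 h3] h0; apply/segmentP; exists (det C A z / det A B C).
have S := det_split A B C z; rewrite h0 add0r in S.
have q (w : R) : 0 <= det A B C * w -> 0 <= w / det A B C.
  move=> h; have -> : w / det A B C = det A B C * w / det A B C ^+ 2 by field.
  by rewrite divr_ge0 ?sqr_ge0.
split; first exact: q.
  have := q _ h2; have -> : det B C z = det A B C - det C A z by lra.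
  by rewrite mulrBl divff // subr_ge0.
have e1 := det_barycentric1 A B C z; have e2 := det_barycentric2 A B C z.
rewrite h0 mul0r addr0 in e1 e2.
rewrite (surjective_pairing z); congr pair; apply: (mulfI n).
  by rewrite e1 (_ : det B C z = det A B C - det C A z) //; [field | lra].
by rewrite e2 (_ : det B C z = det A B C - det C A z) //; [field | lra].
Qed.

(** An interior point is a convex combination of the corners with positive weights. If no corner
    were further to the right, all first coordinates would agree and the triangle would be
    degenerate. *)
Lemma tri_int_corner A B C z : tri_int A B C z ->
  [\/ z.1 < A.1, z.1 < B.1 | z.1 < C.1].
Proof.
move=> [h1 h2 h3].
have e := det_barycentric1 A B C z; have S := det_split A B C z.
have [//|zA] := ltP z.1 A.1; first by constructor 1.
have [//|zB] := ltP z.1 B.1; first by constructor 2.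
have [//|zC] := ltP z.1 C.1; first by constructor 3.
exfalso.
set D := det A B C in h1 h2 h3 e S.
have z0 : D * det B C z * (z.1 - A.1) + D * det C A z * (z.1 - B.1) +
          D * det A B z * (z.1 - C.1) = 0.
  transitivity (D * ((det A B z + det B C z + det C A z) * z.1 -
    (det B C z * A.1 + det C A z * B.1 + det A B z * C.1))); first by ring.
  by rewrite -S -e subrr mulr0.
have g1 : 0 <= D * det B C z * (z.1 - A.1) by rewrite mulr_ge0 ?(ltW h2) ?subr_ge0.
have g2 : 0 <= D * det C A z * (z.1 - B.1) by rewrite mulr_ge0 ?(ltW h3) ?subr_ge0.
have g3 : 0 <= D * det A B z * (z.1 - C.1) by rewrite mulr_ge0 ?(ltW h1) ?subr_ge0.
have zero (p q : R) : 0 < p -> p * (z.1 - q) = 0 -> z.1 = q.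
  by move=> p0 /eqP; rewrite mulf_eq0 (gt_eqF p0) subr_eq0 => /eqP.
have xA : z.1 = A.1 by apply: (zero _ _ h2); lra.
have xB : z.1 = B.1 by apply: (zero _ _ h3); lra.
have xC : z.1 = C.1 by apply: (zero _ _ h1); lra.
have D0 : D = 0 by rewrite /D /det -xA -xB -xC; ring.
by rewrite D0 mul0r ltxx in h1.
Qed.

End Plane.

(** * Triangles framed by edges *)

Section Rings.
Variable R : realType.
Implicit Types (a b c d x y z A B C : R * R) (r s t : R) (O : set (R * R)).

Lemma continuous_det (k : R) A B : continuous (fun z : R * R => k * det A B z).
Proof.
move=> z; apply: cvgM; first exact: cvg_cst.
by apply: cvgB; (apply: cvgM; do ?[exact: cvg_cst]);
  (apply: cvgB; do ?[exact: cvg_cst]); [exact: cvg_snd | exact: cvg_fst].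
Qed.

Lemma open_tri_int A B C : open (tri_int A B C).
Proof.
have -> : tri_int A B C = (fun z => det A B C * det A B z) @^-1` [set r | 0 < r] `&`
   ((fun z => det A B C * det B C z) @^-1` [set r | 0 < r] `&`
   (fun z => det A B C * det C A z) @^-1` [set r | 0 < r]).
  by apply/seteqP; split=> z; [case | case=> ? []].
by do 2?[apply: openI]; apply: open_comp; do ?exact: open_gt;
  move=> w _; exact: continuous_det.
Qed.

Lemma closed_tri A B C : closed (tri A B C).
Proof.
have -> : tri A B C = (fun z => det A B C * det A B z) @^-1` [set r | 0 <= r] `&`
   ((fun z => det A B C * det B C z) @^-1` [set r | 0 <= r] `&`
   (fun z => det A B C * det C A z) @^-1` [set r | 0 <= r]).
  by apply/seteqP; split=> z; [case | case=> ? []].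
by do 2?[apply: closedI]; apply: preimage_closed; do ?exact: closed_ge;
  move=> w _; exact: continuous_det.
Qed.

(** Since [O] avoids the sides, its traces on the closed triangle and on the open one coincide. The
    trace is thus open and closed in [O], and connectedness makes it all of [O]. *)
Lemma connected_tri O A B C : det A B C != 0 -> connected O ->
    O `&` segment A B = set0 -> O `&` segment B C = set0 ->
    O `&` segment C A = set0 ->
  O `&` tri A B C !=set0 -> O `<=` tri_int A B C.
Proof.
move=> n cO oAB oBC oCA meet.
have off (X Y z : R * R) : O `&` segment X Y = set0 -> O z -> ~ segment X Y z.
  by move=> e Oz sz; have : set0 z by rewrite -e.
have triE : O `&` tri A B C = O `&` tri_int A B C.
  apply/seteqP; split=> z [Oz T]; split=> //; last first.
    by case: T => h1 h2 h3; split; exact: ltW.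
  have strict X Y Z : det X Y Z != 0 -> tri X Y Z z ->
      O `&` segment X Y = set0 -> 0 < det X Y Z * det X Y z.
    move=> nX TX oX; rewrite lt_def; case: (TX) => -> _ _; rewrite andbT mulf_neq0 //.
    by apply/eqP => /(tri_side nX TX); exact: off oX Oz.
  split; first exact: strict.
    rewrite -(det_rot A B C); apply: strict; rewrite ?(det_rot A B C) //.
    exact: tri_rot.
  rewrite -(det_rot A B C) -(det_rot B C A).
  by apply: strict; rewrite ?(det_rot B C A) ?(det_rot A B C) //; do 2 apply: tri_rot.
have <- : O `&` tri_int A B C = O; last by move=> z [].
apply: cO; first by rewrite -triE.
  by exists (tri_int A B C); first exact: open_tri_int.
by exists (tri A B C); [exact: closed_tri | rewrite triE].
Qed.

(** The index type is arbitrary, so that a copy may be indexed by ordinals or, for computation, by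
    natural numbers. *)
Definition side (V : Type) (E : rel V) (p : V -> R * R) A B :=
  exists u v, [/\ E u v, segment (p u) (p v) A & segment (p u) (p v) B].

(* The corners of these triangles may be crossings of edges. *)
Definition outside (V : Type) (E : rel V) (p : V -> R * R) O :=
  forall A B C, det A B C != 0 -> side E p A B -> side E p B C ->
    side E p C A -> O `&` tri A B C = set0.

Lemma segment_convex a b x y :
  segment a b x -> segment a b y -> segment x y `<=` segment a b.
Proof.
move=> /segmentP[s [s0 s1 ->]] /segmentP[t [t0 t1 ->]] z /segmentP[r [r0 r1 ->]].
apply/segmentP; exists ((1 - r) * s + r * t); split; [nra | nra |].
by congr pair => /=; ring.
Qed.

(** A framed triangle that meets [O] has its sides inside edges, which [O] avoids, so
    [connected_tri] applies to it. *)
Lemma outside_or (V : Type) (E : rel V) (p : V -> R * R) O :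
    connected O -> (forall u v, E u v -> O `&` segment (p u) (p v) = set0) ->
  outside E p O \/ exists A B C, [/\ side E p A B, side E p B C, side E p C A
    & O `<=` tri_int A B C].
Proof.
move=> cO offO; have [|/existsNP[A /existsNP[B /existsNP[C]]]] := pselect (outside E p O).
  by left.
move=> /not_implyP[n] /not_implyP[AB] /not_implyP[BC] /not_implyP[CA] /eqP/set0P meet.
right; exists A, B, C; split=> //; apply: connected_tri => //.
- case: AB => u [v [uv uA uB]]; apply/seteqP; split=> // z [Oz].
  by move=> /(segment_convex uA uB) uz; rewrite -(offO _ _ uv).
- case: BC => u [v [uv uA uB]]; apply/seteqP; split=> // z [Oz].
  by move=> /(segment_convex uA uB) uz; rewrite -(offO _ _ uv).
- case: CA => u [v [uv uA uB]]; apply/seteqP; split=> // z [Oz].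
  by move=> /(segment_convex uA uB) uz; rewrite -(offO _ _ uv).
Qed.

(* If P were beyond the line AB, the edge carrying BC would have an endpoint w on
   that side, and the segment from w to P would miss the open triangle. *)
Lemma enclosed_half (V : Type) (E : rel V) (p : V -> R * R) O A B C P (k : R) :
    side E p B C -> (forall w, segment (p w) P `&` O !=set0) ->
  (forall z, O z -> 0 < k * det A B z) -> 0 < k * det A B P.
Proof.
move=> [u [v [_ /segmentP[t [t0 t1 Bt]] _]]] block inO.
rewrite ltNge; apply/negP => Pneg.
have wneg w : 0 < k * det A B (p w).
  rewrite ltNge; apply/negP => wneg.
  have [z [/segmentP[s [s0 s1 zE]] /inO]] := block w.
  by rewrite zE det_lerp; nra.
(* [B] lies on the line, yet it is a convex combination of [p u] and [p v], which are strictly on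
   one side of it. *)
have := det_bb A B; rewrite {2}Bt det_lerp => e.
have {}e : (1 - t) * (k * det A B (p u)) + t * (k * det A B (p v)) = 0.
  by rewrite -(mulr0 k) -e; ring.
have h1 : 0 <= (1 - t) * (k * det A B (p u)) 
  by apply: mulr_ge0; [rewrite subr_ge0 | exact/ltW/wneg].
have h2 : 0 <= t * (k * det A B (p v)) by apply: mulr_ge0 => //; exact/ltW/wneg.
have [t0'|t0'] := eqVneq t 0; first by move: e (wneg u); rewrite t0'; lra.
by have : 0 < t * (k * det A B (p v)); [apply: mulr_gt0; rewrite // lt_def t0' | lra].
Qed.

Lemma enclosed (V : Type) (E : rel V) (p : V -> R * R) O A B C P :
    side E p A B -> side E p B C -> side E p C A -> O `<=` tri_int A B C ->
    (forall w, segment (p w) P `&` O !=set0) ->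
  tri_int A B C P.
Proof.
move=> AB BC CA inO block; split.
- by apply: (enclosed_half BC block) => z /inO[].
- by apply: (enclosed_half CA block) => z /inO[].
- by apply: (enclosed_half AB block) => z /inO[].
Qed.

Lemma side_corner (V : Type) (E : rel V) (p : V -> R * R) A B (r : R) :
  side E p A B -> r < A.1 -> exists w, r < (p w).1.
Proof.
move=> [u [v [_ /segmentP[t [t0 t1 ->]] _]]] /=.
have [h _|h] := ltP r (p u).1; first by exists u.
have [h' _|h'] := ltP r (p v).1; first by exists v.
by move=> ?; exfalso; nra.
Qed.

Lemma enclosed_corner (V : Type) (E : rel V) (p : V -> R * R) A B C P :
    side E p A B -> side E p B C -> side E p C A -> tri_int A B C P ->
  exists w, P.1 < (p w).1.
Proof.
move=> AB BC CA /tri_int_corner[].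
- exact: side_corner AB.
- exact: side_corner BC.
- exact: side_corner CA.
Qed.

(* If the obstacle were enclosed by a triangle in each of the two copies, each
   copy would lie inside a triangle of the other one, hence to the left of some
   vertex of the other one. *)
Lemma outside_one (V W : finType) (E : rel V) (F : rel W) (p : V -> R * R)
    (q : W -> R * R) O :
    connected O -> (forall u v, E u v -> O `&` segment (p u) (p v) = set0) ->
    (forall u v, F u v -> O `&` segment (q u) (q v) = set0) ->
    (forall v w, segment (p v) (q w) `&` O !=set0) -> V ->
  outside E p O \/ outside F q O.
Proof.
move=> cO offE offF block v0.
have [?|[A [B [C [AB BC CA inO]]]]] := outside_or cO offE; first by left.
have [?|[A' [B' [C' [AB' BC' CA' inO']]]]] := outside_or cO offF; first by right.
have left_of w : exists v, (q w).1 < (p v).1.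
  apply: (enclosed_corner AB BC CA); apply: (enclosed AB BC CA inO) => v; exact: block.
have right_of v : exists w, (p v).1 < (q w).1.
  apply: (enclosed_corner AB' BC' CA'); apply: (enclosed AB' BC' CA' inO') => w.
  by have [z [/segment_sym zs Oz]] := block v w; exists z.
(* The rightmost vertex of the first copy is left of some vertex of the second, which is left of
   some vertex of the first. *)
have [v _ vmax] := @arg_maxP _ _ _ v0 xpredT (fun v => (p v).1) isT.
have [w vw] := right_of v; have [v' wv'] := left_of w.
by have := lt_le_trans (lt_trans vw wv') (vmax v' isT); rewrite ltxx.
Qed.

(** If [v] were inside the triangle, the whole segment from the corner [a] to [v] would be too, and
    [O] could not meet it. *)
Lemma outside_triangle (V : eqType) (E : rel V) (p : V -> R * R) O (a b c v : V) :
    outside E p O -> E a b -> E b c -> E c a ->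
    segment (p a) (p v) `&` O !=set0 ->
  ~ [/\ 0 < det (p a) (p b) (p v), 0 < det (p b) (p c) (p v)
      & 0 < det (p c) (p a) (p v)].
Proof.
move=> out ab bc ca [z [/segmentP[t [t0 t1 zE]] Oz]] [h1 h2 h3].
have D0 : 0 < det (p a) (p b) (p c) by rewrite (det_split _ _ _ (p v)); lra.
have sideE (i j : V) : E i j -> side E p (p i) (p j).
  by move=> ij; exists i, j; split=> //; [exact: segmentl | exact: segmentr].
have := out _ _ _ _ (sideE _ _ ab) (sideE _ _ bc) (sideE _ _ ca); rewrite gt_eqF //.
move=> /(_ isT)/seteqP[+ _] => /(_ z); apply; split=> //.
have e : det (p b) (p c) (p a) = det (p a) (p b) (p c) by rewrite det_rot.
by split; apply: mulr_ge0; rewrite ?(ltW D0) // zE det_lerp ?det_aa ?det_bb ?e; nra.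
Qed.

(** Replaces signs relative to a factor [k] by signs relative to the orientation of the triangle, as
    [tri] requires. *)
Lemma mulr_ge0_sign (k r s : R) : 0 < k * r -> 0 <= k * s -> 0 <= r * s.
Proof.
move=> kr ks; have k0 : k != 0 by apply/eqP => k0; rewrite k0 mul0r ltxx in kr.
have k2 : 0 < k ^+ 2 by rewrite lt_def sqr_ge0 sqrf_eq0 k0.
have -> : r * s = (k * r) * (k * s) / k ^+ 2 by field.
by rewrite divr_ge0 ?(ltW k2) // mulr_ge0 // ltW.
Qed.

(* The segment cd is covered by the triangles cxy and dxZ, where Z is the crossing
   of dr and xy; k is any number having the sign of the orientation of xyc. *)
Lemma outside_kite (V : eqType) (E : rel V) (p : V -> R * R) O (x y c d r : V)
    (Z : R * R) (k : R) :
    symmetric E -> outside E p O -> E x y -> E x c -> E y c -> E x d -> E d r ->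
    segment (p c) (p d) `&` O !=set0 ->
    segment (p x) (p y) Z -> segment (p d) (p r) Z ->
    0 < k * det (p x) (p y) (p c) -> k * det (p x) (p y) (p d) < 0 ->
    k * det (p c) (p d) (p x) < 0 -> 0 < k * det (p c) (p d) (p y) ->
    0 < k * det (p d) (p r) (p x) -> 0 <= k * det (p c) (p d) (p r) ->
  False.
Proof.
move=> symE out xy xc yc xd dr [z [/segmentP[t [t0 t1 zE]] Oz]] xyZ drZ.
move=> hxyc hxyd hcdx hcdy hdrx hcdr.
have sideE (i j : V) : E i j -> side E p (p i) (p j).
  by move=> ij; exists i, j; split=> //; [exact: segmentl | exact: segmentr].
have k0 (w : R) : 0 < k * w -> w != 0.
  by move=> kw; apply/eqP => w0; rewrite w0 mulr0 ltxx in kw.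
(* The line [x y] cuts [c d] into a part covered by the triangle [x y c] and a part covered by
   [d Z x]. *)
have [zc|zd] := leP 0 (k * det (p x) (p y) z).
  have := out _ _ _ (k0 _ hxyc) (sideE _ _ xy) (sideE _ _ yc) (sideE c x _).
  rewrite symE => /(_ xc)/seteqP[+ _] => /(_ z); apply; split=> //.
  split; apply: (mulr_ge0_sign hxyc) => //; rewrite zE.
    have -> : det (p y) (p c) (lerp (p c) (p d) t) = t * det (p c) (p d) (p y).
      by rewrite /det /=; ring.
    by nra.
  have -> : det (p c) (p x) (lerp (p c) (p d) t) = - (t * det (p c) (p d) (p x)).
    by rewrite /det /=; ring.
  by nra.
have [m [m0 m1 ZxyE]] := proj1 (segmentP _ _ _) xyZ.
have [n [n0 n1 ZdrE]] := proj1 (segmentP _ _ _) drZ.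
(* [Z] differs from [d], which is off the line [x y]; hence the triangle [d Z x] is
   nondegenerate. *)
have npos : 0 < n.
  rewrite lt_def n0 andbT; apply/eqP => n00; move: hxyd.
  suff -> : det (p x) (p y) (p d) = 0 by rewrite mulr0 ltxx.
  have <- : det (p x) (p y) Z = 0 by rewrite ZxyE /det /=; ring.
  by rewrite ZdrE n00 /det /=; ring.
have D : det (p d) Z (p x) = n * det (p d) (p r) (p x).
  by rewrite ZdrE /det /=; ring.
have kD : 0 < k * det (p d) Z (p x) by rewrite D; nra.
have dZ : side E p (p d) Z by exists d, r; split=> //; exact: segmentl.
have Zx : side E p Z (p x) by exists x, y; split=> //; exact: segmentl.
have := out _ _ _ (k0 _ kD) dZ Zx (sideE _ _ xd).
move=> /seteqP[+ _] => /(_ z); apply; split=> //.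
split; apply: (mulr_ge0_sign kD).
- have -> : det (p d) Z z = (1 - t) * (n * det (p c) (p d) (p r)).
    by rewrite zE ZdrE /det /=; ring.
  by rewrite mulrCA mulr_ge0 ?subr_ge0 // mulrCA mulr_ge0.
- have -> : det Z (p x) z = - (m * det (p x) (p y) z).
    by rewrite ZxyE /det /=; ring.
  by nra.
- have -> : det (p x) (p d) z = - ((1 - t) * det (p c) (p d) (p x)).
    by rewrite zE /det /=; ring.
  by nra.
Qed.

(** The line [x y] separates [d] from [r] and the line [d r] separates [x] from [y], so the two
    edges cross and the crossing serves as [Z]. *)
Lemma outside_crossing (V : eqType) (E : rel V) (p : V -> R * R) O (x y c d r : V)
    (k : R) :
    symmetric E -> outside E p O -> E x y -> E x c -> E y c -> E x d -> E d r ->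
    segment (p c) (p d) `&` O !=set0 ->
    0 < k * det (p x) (p y) (p c) -> k * det (p x) (p y) (p d) < 0 ->
    k * det (p c) (p d) (p x) < 0 -> 0 < k * det (p c) (p d) (p y) ->
    0 < k * det (p x) (p y) (p r) -> 0 < k * det (p d) (p r) (p x) ->
    k * det (p d) (p r) (p y) < 0 -> 0 < k * det (p c) (p d) (p r) ->
  False.
Proof.
move=> symE out xy xc yc xd dr block h1 h2 h3 h4 h5 h6 h7 h8.
have k0 : k != 0 by apply/eqP => k0; rewrite k0 mul0r ltxx in h1.
have k2 : 0 < k ^+ 2 by rewrite lt_def sqr_ge0 sqrf_eq0 k0.
have [Z zxy zdr] : exists2 Z, segment (p x) (p y) Z & segment (p d) (p r) Z.
  by apply: segments_meet; rewrite -(pmulr_rlt0 _ k2); nra.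
exact: (outside_kite symE out xy xc yc xd dr block zxy zdr h1 h2 h3 h4 h6 (ltW h8)).
Qed.

(** The kite degenerates to [r = y] with [Z] at [p y]: both covering triangles then have vertices as
    corners. *)
Lemma outside_diamond (V : eqType) (E : rel V) (p : V -> R * R) O (x y c d : V)
    (k : R) :
    symmetric E -> outside E p O -> E x y -> E x c -> E y c -> E x d -> E d y ->
    segment (p c) (p d) `&` O !=set0 ->
    0 < k * det (p x) (p y) (p c) -> k * det (p x) (p y) (p d) < 0 ->
    k * det (p c) (p d) (p x) < 0 -> 0 < k * det (p c) (p d) (p y) ->
  False.
Proof.
move=> symE out xy xc yc xd dy block h1 h2 h3 h4.
have h6 : 0 < k * det (p d) (p y) (p x) by rewrite (det_swap (p y)) det_rot in h2 *; lra.
exact: (outside_kite symE out xy xc yc xd dy block (segmentr _ _) (segmentr _ _)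
  h1 h2 h3 h4 h6 (ltW h4)).
Qed.

End Rings.

(** * Moving to general position *)

Section Perturbation.
Variable R : realType.
Implicit Types (a b c d x y z : R * R) (e r t : R) (D K O : set (R * R)).

Lemma plane_ball x y e :
  ball x e y <-> `|x.1 - y.1| < e /\ `|x.2 - y.2| < e.
Proof. by []. Qed.

(** The [size P] distinct numbers [e / 2], [e / 3], ... in the open interval from 0 to [e] are too
    many to be all roots. *)
Lemma small_nonroot (P : {poly R}) e :
  P != 0 -> 0 < e -> exists t, [/\ 0 < t, t < e & P.[t] != 0].
Proof.
move=> P0 e0; apply/not_existsP => noroot.
pose rs := [seq e / k.+2%:R | k <- iota 0 (size P)].
have : (size rs < size P)%N.
  apply: max_poly_roots P0 _ _.
    apply/allP => _ /mapP[k _ ->]; apply: contra_notT (noroot (e / k.+2%:R)) => nr.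
    by split=> //; rewrite ?divr_gt0 // ltr_pdivrMr // ltr_pMr // ltr1n.
  rewrite map_inj_uniq ?iota_uniq // => i j /(mulfI (lt0r_neq0 e0))/invr_inj/eqP.
  by rewrite eqr_nat => /eqP[].
by rewrite size_map size_iota ltnn.
Qed.

Definition drift (a b : R * R) t : R * R := (a.1 + t * b.1, a.2 + t * b.2).

Lemma drift_det a b c a' b' c' : det a' b' c' != 0 ->
  exists2 P : {poly R}, P != 0 &
    forall t, P.[t] = det (drift a a' t) (drift b b' t) (drift c c' t).
Proof.
move=> n0.
(* The determinant is quadratic in [t] with leading coefficient [det a' b' c']; its middle
   coefficient [m] is read off at [t = 1]. *)
pose m :=
  det (drift a a' 1) (drift b b' 1) (drift c c' 1) - det a b c - det a' b' c'.
exists (Poly [:: det a b c; m; det a' b' c']).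
  apply/eqP => /(congr1 (fun P : {poly R} => P`_2)).
  by rewrite coef_Poly coef0 /= => /eqP; exact/negP.
by move=> t; rewrite horner_Poly /= /m /det /drift /=; ring.
Qed.

(** Points of the parabola [y = x ^ 2]; no three are collinear, because their [det] is a Vandermonde
    product. *)
Definition moment (n : nat) : R * R := (n%:R, n%:R ^+ 2).

Lemma det_moment i j k : uniq [:: i; j; k] -> det (moment i) (moment j) (moment k) != 0.
Proof.
rewrite /= !inE negb_or !andbT => /andP[/andP[ij ik] jk].
have -> : det (moment i) (moment j) (moment k) =
    (j%:R - i%:R) * (k%:R - i%:R) * (k%:R - j%:R) by rewrite /det /moment /=; ring.
by rewrite !mulf_neq0 // subr_eq0 eqr_nat eq_sym.
Qed.

(** All points drift at once towards points of the parabola. For each triple the determinant is a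
    nonzero polynomial in the time [t], and a small [t] avoids the roots of the product of all of
    them. *)
Lemma general_position (T : finType) (p : T -> R * R) e : 0 < e ->
  exists q : T -> R * R, (forall v, ball (p v) e (q v)) /\
    forall i j k, uniq [:: i; j; k] -> det (q i) (q j) (q k) != 0.
Proof.
move=> e0; pose m (v : T) := moment (enum_rank v).
have mP i j k : uniq [:: i; j; k] -> det (m i) (m j) (m k) != 0.
  move=> u; apply: det_moment.
  by have := map_inj_uniq (inj_comp val_inj enum_rank_inj) [:: i; j; k]; rewrite u.
have /choice[P PP] (w : T * T * T) : exists P : {poly R}, uniq [:: w.1.1; w.1.2; w.2] ->
    P != 0 /\ forall t, P.[t] = det (drift (p w.1.1) (m w.1.1) t)
      (drift (p w.1.2) (m w.1.2) t) (drift (p w.2) (m w.2) t).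
  have [u|_] := boolP (uniq [:: w.1.1; w.1.2; w.2]); last by exists 0.
  by have [P P0 PE] := drift_det (p w.1.1) (p w.1.2) (p w.2) (mP _ _ _ u); exists P.
pose Q := \prod_(w : T * T * T | uniq [:: w.1.1; w.1.2; w.2]) P w.
have Q0 : Q != 0 by apply/prodf_neq0 => w /PP[].
(* Exceeds every coordinate of the drift directions, since ranks are at most [#|T|]. *)
pose M : R := (#|T| ^ 2).+1%:R.
have M0 : 0 < M by rewrite ltr0n.
have [t [t0 te Qt]] := small_nonroot Q0 (divr_gt0 e0 M0).
have tM : t * M < e by rewrite -ltr_pdivlMr.
exists (fun v => drift (p v) (m v) t); split.
  move=> v; have lt n : (n <= #|T| ^ 2)%N -> `|t * n%:R| < e.
    move=> nT; rewrite ger0_norm ?mulr_ge0 ?(ltW t0) //; apply: le_lt_trans tM.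
    by rewrite ler_wpM2l ?(ltW t0) // ler_nat (leq_trans nT).
  have vT := ltnW (ltn_ord (enum_rank v)).
  have bound n : (n <= #|T|)%N -> `|t * n%:R| < e /\ `|t * n%:R ^+ 2| < e.
    move=> nT; have n2 : (n ^ 2 <= #|T| ^ 2)%N by rewrite leq_exp2r.
    rewrite -natrX; split; apply: lt => //; apply: leq_trans n2.
    by case: n {nT} => // n; rewrite expnS expn1 leq_pmulr.
  have [h1 h2] := bound _ vT; apply/plane_ball.
  by rewrite /= !opprD !addrA !subrr !sub0r !normrN.
move=> i j k u; move: Qt; rewrite horner_prod => /prodf_neq0/(_ (i, j, k) u).
by have [_ ->] := PP (i, j, k) u.
Qed.

Lemma lerp_ball a b a' b' t e : 0 <= t -> t <= 1 ->
  ball a e a' -> ball b e b' -> ball (lerp a b t) e (lerp a' b' t).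
Proof.
move=> t0 t1 /plane_ball[a1 a2] /plane_ball[b1 b2].
have lip (u v u' v' : R) : `|u - u'| < e -> `|v - v'| < e ->
    `|(1 - t) * u + t * v - ((1 - t) * u' + t * v')| < e.
  move=> h1 h2; have -> : (1 - t) * u + t * v - ((1 - t) * u' + t * v') =
    (1 - t) * (u - u') + t * (v - v') by ring.
  (* Weak bounds by some [M < e] survive multiplication by weights that may be zero. *)
  have [M [hu hv Me]] : exists M, [/\ `|u - u'| <= M, `|v - v'| <= M & M < e].
    by exists (Num.max `|u - u'| `|v - v'|); rewrite !le_max !lexx orbT gt_max h1 h2.
  apply: le_lt_trans Me; move: hu hv; rewrite !ler_norml.
  by move=> /andP[g1 g2] /andP[g3 g4]; apply/andP; split; nra.
by apply/plane_ball; split; exact: lip.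
Qed.

Lemma segment_ball a b z e : 0 < e -> ball a e b -> segment a b z -> ball a e z.
Proof.
move=> e0 ab /segmentP[t [t0 t1 ->]].
have {1}-> : a = lerp a a t by rewrite (surjective_pairing a); congr pair => /=; ring.
by apply: lerp_ball => //; exact: ballxx.
Qed.

Lemma continuous_lerp a b : continuous (lerp a b).
Proof.
move=> t; have aff (u v : R) : (1 - s) * u + s * v @[s --> t] --> (1 - t) * u + t * v.
  by apply: cvgD; apply: cvgM; do ?exact: cvg_cst; do ?exact: cvg_id;
    apply: cvgB; [exact: cvg_cst | exact: cvg_id].
exact: (cvg_pair (aff a.1 b.1) (aff a.2 b.2)).
Qed.

Lemma segmentE a b : segment a b = lerp a b @` `[0, 1].
Proof.
apply/seteqP; split=> z.
  by move=> /segmentP[t [t0 t1 ->]]; exists t => //=; rewrite in_itv /= t0.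
by move=> [t]; rewrite /= in_itv /= => /andP[t0 t1] <-; exact: segment_lerp.
Qed.

Lemma connected_segment a b : connected (segment a b).
Proof.
rewrite segmentE; apply: connected_continuous_connected; first exact: segment_connected.
exact/continuous_subspaceT/continuous_lerp.
Qed.

Lemma closed_segment a b : closed (segment a b).
Proof.
rewrite segmentE; apply: compact_closed; first exact: norm_hausdorff.
apply: continuous_compact; last exact: segment_compact.
exact/continuous_subspaceT/continuous_lerp.
Qed.

End Perturbation.

(** * Stability of a one-obstacle representation under small motions *)

Section Stability.
Variables (R : realType) (G : sgraph).
Implicit Types (x y z : R * R) (e r t : R) (D K O : set (R * R)) (p q : G -> R * R).

Lemma closed_drawing p : closed (drawing p).
Proof.
have -> : drawing p = \bigcup_(v in [set: G]) [set p v] `|`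
    \bigcup_(w in [set w : G * G | edge w.1 w.2]) segment (p w.1) (p w.2).
  apply/seteqP; split=> z.
  - move=> [[v ->]|[u [v [uv zs]]]]; [by left; exists v | by right; exists (u, v)].
  - move=> [[v _ ->]|[[u v] uv zs]]; [by left; exists v | by right; exists u, v].
apply: closedU; apply: closed_bigcup; do ?exact: finite_finset.
- by move=> v _; apply: accessible_closed_set1; exact/hausdorff_accessible/norm_hausdorff.
- by move=> w _; exact: closed_segment.
Qed.

(* Unlike lying in a common connected subset of the complement of D, this relation
   survives a small motion of D. *)
Definition linked D x y := exists e K,
  [/\ 0 < e, connected K, K x, K y & forall z d, K z -> D d -> ~ ball z e d].

Lemma linked_sym D x y : linked D x y -> linked D y x.
Proof. by move=> [e [K [*]]]; exists e, K. Qed.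

Lemma linked_trans D x y z : linked D x y -> linked D y z -> linked D x z.
Proof.
move=> [e [K [e0 cK Kx Ky clr]]] [e' [K' [e'0 cK' K'y K'z clr']]].
exists (Num.min e e'), (K `|` K'); split; [by rewrite lt_min e0 | | by left | by right |].
  by apply: connectedU => //; exists y.
move=> w d [Kw|K'w] Dd wd.
- by apply: clr Kw Dd _; apply: le_ball wd; rewrite ge_min lexx.
- by apply: clr' K'w Dd _; apply: le_ball wd; rewrite ge_min lexx orbT.
Qed.

(** If the ball of radius [r] about [x] misses [D], the segment from [x] to a point within [r / 2]
    keeps the margin [r / 2]. *)
Lemma linked_near D x : closed D -> ~ D x -> \forall y \near x, linked D x y.
Proof.
move=> cD nDx; have : nbhs x (~` D).
  by apply: open_nbhs_nbhs; split=> //; exact: closed_openC.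
move=> /nbhs_ballP[r /= r0 xr]; apply/nbhs_ballP; exists (r / 2).
  by rewrite /= divr_gt0.
move=> y xy; exists (r / 2), (segment x y); split.
- by rewrite divr_gt0.
- exact: connected_segment.
- exact: segmentl.
- exact: segmentr.
move=> z d /(segment_ball _ xy) xz Dd zd; apply: xr Dd.
by rewrite [r]splitr; apply: ball_triangle zd; apply: xz; rewrite divr_gt0.
Qed.

(** By [linked_near], the points linked to [x] form an open set, and so do the points off [D] that
    are not. The first set is therefore open and closed in [O]. *)
Lemma linked_connected D O x y :
  closed D -> connected O -> O `&` D = set0 -> O x -> O y -> linked D x y.
Proof.
move=> cD cO OD Ox Oy.
have nD z : O z -> ~ D z by move=> Oz Dz; have : set0 z by rewrite -OD.
have oL : open [set z | linked D x z].
  rewrite openE => z xz; case: (xz) => e [K [e0 _ _ Kz clr]].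
  have nDz : ~ D z by move=> /(clr _ _ Kz); apply; exact: ballxx.
  by apply: filterS (linked_near cD nDz) => w; exact: linked_trans.
have oN : open [set z | ~ D z /\ ~ linked D x z].
  rewrite openE => z [nDz nxz].
  have : nbhs z (~` D) by apply: open_nbhs_nbhs; split=> //; exact: closed_openC.
  apply: filterS2 (linked_near cD nDz) => w zw nDw; split=> // xw.
  by apply: nxz; apply: linked_trans xw (linked_sym zw).
suff /seteqP[_ /(_ y Oy)[]] : O `&` [set z | linked D x z] = O by [].
apply: cO.
- by exists x; split=> //; exact: nbhs_singleton (linked_near cD (nD x Ox)).
- by exists [set z | linked D x z].
exists (~` [set z | ~ D z /\ ~ linked D x z]); first exact: open_closedC.
apply/seteqP; split=> z [Oz xz]; split=> //; first by case.
by apply: contrapT => nxz; apply: xz; split=> //; exact: nD.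
Qed.

Lemma drawing_ball p q e z : 0 < e -> (forall v, ball (p v) e (q v)) ->
  drawing q z -> exists2 d, drawing p d & ball d e z.
Proof.
move=> e0 pq [[v ->]|[u [v [uv /segmentP[t [t0 t1 ->]]]]]].
  by exists (p v) => //; left; exists v.
exists (lerp (p u) (p v) t); last exact: lerp_ball.
by right; exists u, v; split=> //; exact: segment_lerp.
Qed.

(** One point of [O] is chosen on each nonedge, and these points are linked to one of them with a
    common margin [e]. After a motion below [e / 2], the linking sets, prolonged by short segments
    to the moved points, form the new obstacle. *)
Lemma perturb p O :
    connected O -> O `&` drawing p = set0 ->
    (forall u v, @nonedge G u v -> segment (p u) (p v) `&` O !=set0) ->
  exists q O', [/\ forall i j k, uniq [:: i; j; k] -> det (q i) (q j) (q k) != 0,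
    connected O', O' `&` drawing q = set0 &
    forall u v, @nonedge G u v -> segment (q u) (q v) `&` O' !=set0].
Proof.
move=> cO Op block.
have cD : closed (drawing p) by exact: closed_drawing.
have /choice[t tP] (w : G * G) : exists t, nonedge w.1 w.2 ->
    [/\ 0 <= t, t <= 1 & O (lerp (p w.1) (p w.2) t)].
  have [/block|_] := boolP (nonedge w.1 w.2); last by exists 0.
  move=> [z [/segmentP[t [t0 t1 ->]] Oz]].
  by exists t.
(* With no nonedges the empty obstacle suffices; otherwise the point on [w0] is the base of all
   links. *)
have [[w0 w0n]|noN] := pselect (exists w : G * G, nonedge w.1 w.2); last first.
  have [q [_ qP]] := general_position p ltr01.
  exists q, set0; split=> //; rewrite ?set0I //.
    by move=> B [z Bz] [C _ e]; move: Bz; rewrite e set0I.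
  by move=> u v uv; case: noN; exists (u, v).
pose z (w : G * G) := lerp (p w.1) (p w.2) (t w).
have Oz w : nonedge w.1 w.2 -> O (z w) by move=> /tP[].
pose linked_at (e : R) (w : G * G) := exists K, nonedge w.1 w.2 ->
  [/\ connected K, K (z w0), K (z w) & forall y d, K y -> drawing p d -> ~ ball y e d].
(* As there are finitely many pairs, one margin serves them all. *)
have linked_small : \forall e \near 0^'+, forall w, linked_at e w.
  apply: filter_forall => w; have [wn|nw] := boolP (nonedge w.1 w.2); last first.
    by near=> e; exists set0 => wn; rewrite wn in nw.
  have [e [K [e0 cK K0 Kw clr]]] := linked_connected cD cO Op (Oz _ w0n) (Oz _ wn).
  near=> e'; exists K => _; split=> // y d Ky Dd yd; apply: clr Ky Dd _.
  by apply: le_ball yd; apply: ltW; near: e'; exact: nbhs_right_lt.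
have [e [e0 /choice[K KP]]] : exists e, 0 < e /\ forall w, linked_at e w.
  near (0 : R)^'+ => e; exists e; split; [by [] | by near: e].
have e20 : 0 < e / 2 by rewrite divr_gt0.
(* Half of the margin pays for the motion of the drawing, the other half for the added segments. *)
have [q [pq qP]] := general_position p e20.
pose z' (w : G * G) := lerp (q w.1) (q w.2) (t w).
have zz' w : nonedge w.1 w.2 -> ball (z w) (e / 2) (z' w).
  by move=> /tP[t0 t1 _]; exact: lerp_ball.
pose O' := \bigcup_(w in [set w : G * G | nonedge w.1 w.2])
  (K w `|` segment (z w) (z' w)).
exists q, O'; split=> //.
- apply: bigcup_connected; first by exists (z w0) => w /= wn; left; case: (KP w wn).
  move=> w /= wn; have [cK _ Kz _] := KP w wn.
  apply: connectedU => //; last exact: connected_segment.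
  by exists (z w); split=> //; exact: segmentl.
- apply/seteqP; split=> // y [[w /= wn yw] /(drawing_ball e20 pq)[d Dd dy]].
  have [cK _ Kz clr] := KP w wn.
  case: yw => [Ky|/(segment_ball e20 (zz' w wn)) zy].
    apply: clr Ky Dd _; apply/ball_sym; apply: le_ball dy.
    by rewrite ler_pdivrMr // ler_peMr ?ler1n // ltW.
  by apply: clr Kz Dd _; rewrite [e]splitr; apply: ball_triangle zy _; exact/ball_sym.
- move=> u v uv; have [t0 t1 _] := tP (u, v) uv.
  exists (z' (u, v)); split; first exact: segment_lerp.
  by exists (u, v) => //; right; exact: segmentr.
Unshelve. all: by end_near.
Qed.

End Stability.

(** * The orientations of one copy *)

Section Clauses.
Local Open Scope nat_scope.

(** * Clause sets and their refutation by unit propagation and case distinction *)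

Definition lit : Type := (nat * nat * nat) * bool.

Definition negate (l : lit) : lit := (l.1, ~~ l.2).

Definition holds (val : nat -> nat -> nat -> bool) (l : lit) : bool :=
  val l.1.1.1 l.1.1.2 l.1.2 == l.2.

Definition assign (l : lit) (cs : seq (seq lit)) : seq (seq lit) :=
  [seq [seq k <- c | k != negate l] | c <- cs & l \notin c].

(** Unit propagation with fuel [n]. Stopping early is sound, as every step preserves models. *)
Fixpoint propagate (n : nat) (cs : seq (seq lit)) : seq (seq lit) :=
  if n is n'.+1 then
    if [seq c <- cs | size c == 1] is (l :: _) :: _ then
      propagate n' (assign l cs)
    else cs
  else cs.

Arguments propagate : simpl never.

Inductive dtree := Leaf | Node of nat & nat & nat & dtree & dtree.

(* 120 is the number of triples of a ten-element set, that is, of variables. *)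
Fixpoint refutes (t : dtree) (cs : seq (seq lit)) : bool :=
  let cs := propagate 120 cs in
  ([::] \in cs) ||
  if t is Node i j k t1 t2 then
    refutes t1 (assign ((i, j, k), true) cs) &&
    refutes t2 (assign ((i, j, k), false) cs)
  else false.

Definition models (val : nat -> nat -> nat -> bool) (cs : seq (seq lit)) :=
  all (has (holds val)) cs.

Lemma holds_negate val l : holds val (negate l) = ~~ holds val l.
Proof. by case: l => [[[i j] k] []]; rewrite /holds /=; case: val. Qed.

Lemma models_assign val l cs :
  holds val l -> models val cs -> models val (assign l cs).
Proof.
move=> hl /allP m; apply/allP => c' /mapP[c]; rewrite mem_filter => /andP[_ cin ->].
have /hasP[k kc hk] := m _ cin; apply/hasP; exists k => //.
rewrite mem_filter kc andbT /=; apply/eqP => kE.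
by move: hk; rewrite kE holds_negate hl.
Qed.

Lemma models_propagate val n cs : models val cs -> models val (propagate n cs).
Proof.
elim: n cs => [|n IH] cs m; rewrite /propagate -/propagate //.
case E: [seq c <- cs | size c == 1] => [//|[//|l c] s].
have : l :: c \in [seq c <- cs | size c == 1] by rewrite E mem_head.
rewrite mem_filter /= => /andP[/eqP[/size0nil c0] lin].
apply: IH; apply: models_assign => //.
by have /allP/(_ _ lin) := m; rewrite c0 has_seq1.
Qed.

(** Soundness of the certificate: propagation keeps [val] a model, so does assigning whichever
    literal [val] makes true at a node, and the empty clause has no model. *)
Lemma refutesP val t cs : refutes t cs -> ~~ models val cs.
Proof.
elim: t cs => [|i j k t1 IH1 t2 IH2] cs /=; apply: contraL => m.
- rewrite orbF; apply/negP => nin.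
  by have /allP/(_ _ nin) := models_propagate 120 m.
- rewrite negb_or; apply/andP; split.
    by apply/negP => nin; have /allP/(_ _ nin) := models_propagate 120 m.
  have {}m := models_propagate 120 m.
  rewrite negb_and; case h: (holds val ((i, j, k), true)).
    by apply/orP; left; apply/negP => /IH1; rewrite models_assign.
  apply/orP; right; apply/negP => /IH2; rewrite models_assign //.
  by move: h; rewrite /holds /=; case: (val i j k).
Qed.

(* The literal asserting that i, j, k turn left if b holds and right otherwise;
   the three indices are sorted so that each triple yields one variable. *)
Definition turn (b : bool) (i j k : nat) : lit :=
  if i < j then
    if j < k then ((i, j, k), b) else
    if i < k then ((i, k, j), ~~ b) else ((k, i, j), b)
  else
    if i < k then ((j, i, k), ~~ b) else
    if j < k then ((j, k, i), b) else ((k, j, i), ~~ b).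

(* The points on one side of the line ts are linearly ordered by rotation about t. *)
Definition fan (b : bool) (w : nat * nat * nat * nat * nat) : seq lit :=
  let: (t, s, p, q, r) := w in
  [:: turn (~~ b) t s p; turn (~~ b) t s q; turn (~~ b) t s r;
      turn false t p q; turn false t q r; turn true t p r].

(** Denies the three conditions of [outside_triangle]; the clockwise case is the tuple with [b] and
    [c] exchanged. *)
Definition triangle_clause (w : nat * nat * nat * nat) : seq lit :=
  let: (a, b, c, v) := w in [:: turn false a b v; turn false b c v; turn false c a v].

(** Denies the sign conditions of [outside_diamond], with [k] positive or negative according to
    [b]. *)
Definition diamond (b : bool) (w : nat * nat * nat * nat) : seq lit :=
  let: (x, y, c, d) := w in
  [:: turn (~~ b) x y c; turn b x y d; turn b c d x; turn (~~ b) c d y].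

(** Denies the sign conditions of [outside_crossing] in the same way. *)
Definition kite (b : bool) (w : nat * nat * nat * nat * nat) : seq lit :=
  let: (x, y, c, d, r) := w in
  [:: turn (~~ b) x y r, turn (~~ b) d r x, turn b d r y, turn (~~ b) c d r &
   diamond b (x, y, c, d)].

(* The following instances of the clauses, and the case distinction showing that they
   are inconsistent, were found with a SAT solver. *)
Definition fans_left : seq (nat * nat * nat * nat * nat) := [::
  (0,1,2,3,4); (0,1,2,3,7); (0,1,2,3,8); (0,1,2,5,7); (0,1,2,8,3);
  (0,1,3,5,4); (0,1,3,5,6); (0,1,4,6,5); (0,1,4,7,5); (0,1,4,9,5);
  (0,2,3,5,8); (0,2,3,8,4); (0,2,3,8,5); (0,3,1,8,2); (0,3,2,4,8);
  (0,3,2,8,4); (0,3,2,8,5); (0,4,1,9,2); (0,4,2,3,8); (0,5,1,7,2);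
  (0,5,2,9,3); (0,5,3,4,9); (1,0,2,3,4); (1,0,2,4,3); (1,0,2,9,4);
  (1,0,3,4,5); (1,0,3,5,4); (1,0,3,5,9); (1,2,4,5,9); (1,3,0,6,4);
  (1,3,0,6,5); (1,3,2,4,5); (1,3,4,7,5); (1,4,0,8,2); (1,4,2,3,7);
  (1,4,3,7,5); (1,5,0,9,3); (1,5,2,9,3); (1,5,3,4,8); (2,0,1,3,9);
  (2,0,1,4,7); (2,0,3,4,8); (2,1,0,3,9); (2,3,0,7,5); (2,3,1,4,9);
  (2,4,0,1,3); (2,4,0,3,1); (2,4,0,3,5); (2,4,1,3,5); (2,4,1,5,3);
  (2,4,1,9,3); (2,4,3,5,6); (2,4,3,5,8); (2,5,0,8,3); (3,0,1,2,7);
  (3,0,1,2,8); (3,0,1,2,9); (3,0,2,4,8); (3,0,2,5,8); (3,1,0,2,4);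
  (3,1,0,2,7); (3,1,2,5,7); (3,1,4,5,6); (3,2,1,5,7); (3,2,1,7,4);
  (3,2,4,5,9); (3,4,0,1,7); (3,4,0,5,6); (3,4,0,8,2); (3,4,1,7,2);
  (3,5,0,1,4); (3,5,0,1,6); (3,5,0,4,2); (3,5,0,6,4); (3,5,1,2,4);
  (3,5,1,2,6); (3,5,1,2,7); (3,5,1,2,9); (3,5,1,7,4); (3,5,2,4,6);
  (4,0,1,3,6); (4,0,1,3,9); (4,0,2,6,5); (4,0,2,9,3); (4,1,0,2,8);
  (4,1,2,7,3); (4,2,0,1,3); (4,2,0,3,5); (4,2,0,3,8); (4,2,0,5,1);
  (4,2,0,9,1); (4,2,1,3,7); (4,2,1,5,7); (4,2,1,8,3); (4,2,3,6,5);
  (4,3,0,2,8); (4,3,1,2,7); (4,3,1,6,5); (4,5,0,9,3); (4,5,1,2,7);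
  (5,0,1,3,6); (5,0,1,4,7); (5,0,2,3,7); (5,1,3,8,4); (5,2,0,6,4);
  (5,3,0,1,8); (5,3,0,1,9); (5,3,0,2,8); (5,3,1,2,4); (5,3,1,6,4);
  (5,3,1,9,4); (5,4,0,3,9); (5,4,0,7,2); (6,5,0,1,2); (6,5,0,2,4);
  (8,2,0,5,3); (9,0,2,3,4)].

Definition fans_right : seq (nat * nat * nat * nat * nat) := [::
  (0,1,2,3,4); (0,1,2,3,5); (0,1,2,3,8); (0,1,2,3,9); (0,1,2,4,3);
  (0,1,2,4,5); (0,1,2,4,7); (0,1,2,5,3); (0,1,2,6,4); (0,1,2,7,3);
  (0,1,2,7,5); (0,1,3,4,5); (0,1,3,4,6); (0,1,3,4,8); (0,1,3,4,9);
  (0,1,4,5,6); (0,1,4,6,5); (0,1,4,9,5); (0,2,1,4,7); (0,2,1,5,8);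
  (0,2,3,4,8); (0,2,3,5,8); (0,2,3,8,5); (0,3,1,2,8); (0,3,2,5,4);
  (0,3,2,8,4); (0,4,1,2,9); (0,4,2,8,3); (0,5,1,3,7); (0,5,3,7,4);
  (1,0,2,3,5); (1,0,2,3,9); (1,0,2,4,3); (1,0,2,4,6); (1,0,2,5,4);
  (1,0,2,7,4); (1,0,3,4,5); (1,0,3,5,4); (1,0,4,6,5); (1,2,0,3,9);
  (1,2,0,4,6); (1,2,0,4,9); (1,3,0,5,6); (1,3,4,5,7); (1,4,0,2,8);
  (1,4,2,7,3); (1,5,0,2,7); (1,5,2,3,9); (1,5,3,8,4); (2,0,1,7,3);
  (2,0,1,8,3); (2,0,3,5,8); (2,1,0,9,3); (2,1,3,6,4); (2,1,3,9,4);
  (2,1,3,9,5); (2,3,0,1,5); (2,3,0,1,9); (2,3,0,5,7); (2,3,1,5,9);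
  (2,4,0,1,7); (2,4,0,3,5); (2,4,0,5,1); (2,4,0,5,3); (2,4,0,6,1);
  (2,4,1,3,5); (2,4,1,5,3); (2,4,1,9,3); (2,4,3,6,5); (2,5,0,3,8);
  (3,0,1,8,2); (3,0,1,9,5); (3,0,2,4,8); (3,0,2,8,5); (3,1,4,7,5);
  (3,2,0,1,9); (3,2,1,4,7); (3,4,0,2,8); (3,4,1,6,5); (3,5,0,1,2);
  (3,5,0,1,8); (3,5,0,2,4); (3,5,0,4,1); (3,5,0,4,6); (3,5,1,4,2);
  (3,5,1,4,6); (3,5,1,4,7); (3,5,1,7,2); (3,5,2,4,9); (3,5,2,6,4);
  (4,0,1,6,2); (4,0,1,6,3); (4,0,1,9,2); (4,0,2,5,6); (4,1,0,7,2);
  (4,1,0,8,2); (4,1,3,8,5); (4,2,0,1,5); (4,2,0,5,3); (4,2,0,7,1);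
  (4,2,0,8,1); (4,2,1,6,3); (4,2,1,7,3); (4,2,1,8,5); (4,2,3,7,5);
  (4,2,3,9,5); (4,3,0,5,6); (4,5,0,3,9); (4,5,2,3,7); (5,0,1,6,4);
  (5,0,1,7,4); (5,1,0,9,3); (5,1,2,8,3); (5,1,2,8,4); (5,2,0,4,6);
  (5,3,0,1,2); (5,3,0,2,1); (5,3,0,4,9); (5,3,0,8,1); (5,3,0,8,2);
  (5,3,1,4,2); (5,3,1,9,2); (5,3,2,9,4); (5,4,1,2,7); (6,1,0,4,2);
  (6,3,1,2,4); (6,5,0,4,2); (8,3,0,1,2)].

Definition triangles : seq (nat * nat * nat * nat) := [::
  (0,2,5,1); (0,2,6,1); (0,2,9,1); (0,3,2,1); (0,3,6,1); (0,4,3,1); (0,4,7,1);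
  (0,4,8,1); (0,5,4,1); (0,5,8,1); (0,6,3,1); (0,7,3,1); (0,8,4,1); (0,8,5,1);
  (0,9,2,1); (1,2,3,0); (1,2,5,9); (1,3,4,0); (1,3,4,7); (1,4,3,7); (1,4,5,0);
  (1,5,2,0); (1,5,2,9); (2,0,3,8); (2,0,5,4); (2,0,9,4); (2,1,3,4); (2,3,0,4);
  (2,3,0,7); (2,3,0,8); (2,3,6,4); (2,5,1,4); (2,5,9,4); (2,6,3,4); (2,9,0,4);
  (2,9,5,4); (3,0,2,9); (3,0,4,5); (3,0,4,8); (3,0,6,5); (3,0,7,5); (3,1,2,5);
  (3,2,0,5); (3,2,6,5); (3,4,1,5); (3,4,7,5); (3,6,0,5); (3,6,2,5); (3,7,0,5);
  (3,7,4,5); (4,0,3,2); (4,0,3,6); (4,0,7,2); (4,0,8,2); (4,1,5,2); (4,3,1,2);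
  (4,5,0,2); (4,7,0,2); (4,8,0,2); (5,0,2,3); (5,0,8,3); (5,0,9,3); (5,1,4,3);
  (5,2,1,3); (5,2,9,3); (5,4,0,3); (5,8,0,3); (5,9,0,3); (5,9,2,3); (6,0,3,4);
  (6,2,3,1); (6,3,0,4); (7,0,3,2); (7,3,0,2); (7,3,4,1); (7,4,3,1); (8,0,4,3);
  (8,0,5,2); (8,4,0,3); (8,5,0,2); (9,0,2,3); (9,0,5,4); (9,2,5,1); (9,5,0,4);
  (9,5,2,1)].

Definition diamonds : seq (nat * nat * nat * nat) := [::
  (0,2,3,5); (0,2,3,9); (0,3,2,4); (0,3,2,7); (0,3,4,6); (0,4,3,5); (0,4,3,8);
  (0,5,2,4); (0,5,2,8); (1,2,3,5); (1,3,2,4); (1,4,3,5); (1,5,2,4); (2,3,0,1);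
  (2,3,1,6); (2,5,0,1); (2,5,1,9); (3,4,0,1); (3,4,1,7); (4,5,0,1)].

Definition kites_left : seq (nat * nat * nat * nat * nat) := [::
  (0,2,3,8,4); (0,2,3,8,5); (0,2,6,4,1); (0,2,9,4,3); (0,3,2,8,4);
  (0,3,6,5,4); (0,4,3,9,5); (0,4,7,2,5); (0,4,8,2,1); (0,4,8,2,3);
  (0,5,4,6,2); (2,0,6,1,5); (2,0,9,1,3); (2,3,1,9,0); (2,3,6,5,0);
  (2,3,6,5,1); (2,5,1,6,0); (2,5,9,3,1); (4,0,7,1,5); (4,1,5,7,3);
  (4,3,1,8,0); (4,3,7,5,1); (4,5,8,3,1); (5,1,2,8,4); (5,2,9,4,1)].

Definition kites_right : seq (nat * nat * nat * nat * nat) := [::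
  (0,2,3,8,5); (0,2,5,7,3); (0,2,9,4,3); (0,3,6,5,4); (0,3,7,5,2);
  (0,4,3,9,5); (0,4,7,2,5); (0,5,4,6,2); (2,0,9,1,4); (2,3,6,5,1);
  (2,5,9,3,1); (3,0,6,1,4); (3,1,2,7,0); (3,1,2,7,4); (3,2,1,7,0);
  (3,2,6,4,1); (3,4,1,6,0); (3,4,7,2,1); (4,0,7,1,2); (4,0,7,1,5);
  (4,3,1,8,0); (4,5,8,3,1); (5,0,8,1,2); (5,2,1,8,0); (5,2,9,4,1); (5,4,1,9,0)].

Definition case_split : dtree :=
  (Node 0 1 2 (Node 3 4 5 (Node 2 3 5 (Node 1 3 5 Leaf Leaf) (Node 0 3 5 Leaf
  (Node 2 3 4 (Node 1 3 4 (Node 0 2 4 Leaf (Node 0 1 3 (Node 0 1 4 (Node 1 4 5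
  Leaf (Node 2 4 5 Leaf (Node 1 2 4 Leaf (Node 0 3 8 (Node 0 2 8 Leaf Leaf)
  (Node 0 2 8 Leaf Leaf))))) Leaf) Leaf)) (Node 0 2 3 (Node 0 2 4 Leaf
  (Node 2 4 5 Leaf (Node 0 3 8 (Node 0 2 8 Leaf (Node 1 2 4 Leaf Leaf))
  (Node 0 2 8 Leaf Leaf)))) Leaf)) (Node 1 2 4 (Node 0 1 3 (Node 0 1 4
  (Node 1 4 5 (Node 1 3 4 Leaf (Node 0 2 4 (Node 2 3 9 (Node 1 2 9 Leaf Leaf)
  (Node 1 2 9 Leaf Leaf)) Leaf)) (Node 1 5 9 (Node 2 4 5 (Node 0 2 4
  (Node 2 3 9 (Node 0 4 9 Leaf (Node 1 2 9 Leaf Leaf)) (Node 1 2 9 Leaf Leaf))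
  Leaf) Leaf) (Node 2 4 5 (Node 0 2 4 (Node 3 5 9 (Node 0 4 9 Leaf Leaf) Leaf)
  Leaf) Leaf))) Leaf) Leaf) Leaf)))) (Node 0 3 5 (Node 2 3 5 (Node 0 1 3
  (Node 0 1 4 (Node 0 1 5 (Node 1 3 5 (Node 2 3 4 (Node 1 3 7 (Node 0 3 4
  (Node 3 4 7 (Node 0 2 4 Leaf (Node 2 4 5 Leaf Leaf)) (Node 0 2 4 Leaf
  (Node 2 4 5 Leaf Leaf))) (Node 0 2 5 (Node 1 2 4 Leaf (Node 2 3 7 Leaf
  Leaf)) Leaf)) (Node 0 3 4 (Node 3 4 7 (Node 0 2 4 Leaf (Node 2 4 5 Leaf
  Leaf)) (Node 0 2 4 Leaf (Node 2 4 5 Leaf Leaf))) (Node 0 2 5 (Node 1 2 4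
  Leaf (Node 0 2 7 Leaf Leaf)) Leaf))) (Node 3 5 6 (Node 3 4 6 (Node 1 3 6
  (Node 1 3 4 (Node 2 4 5 (Node 0 2 4 Leaf Leaf) Leaf) Leaf) (Node 1 3 4
  (Node 2 4 5 (Node 0 2 4 Leaf Leaf) Leaf) (Node 1 2 4 Leaf Leaf)))
  (Node 1 3 4 (Node 1 2 5 Leaf (Node 0 2 4 Leaf Leaf)) (Node 1 2 3 (Node 1 3 6
  Leaf Leaf) Leaf))) (Node 0 1 6 (Node 1 3 4 (Node 1 2 5 Leaf (Node 0 2 4 Leaf
  Leaf)) (Node 1 2 4 (Node 1 2 6 Leaf Leaf) Leaf)) Leaf))) Leaf) Leaf) Leaf)
  Leaf) Leaf) Leaf)) (Node 0 1 5 Leaf (Node 3 4 5 (Node 1 3 5 Leaf (Node 2 3 5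
  Leaf (Node 0 3 5 Leaf (Node 0 1 4 Leaf (Node 0 1 3 Leaf (Node 0 3 4
  (Node 3 4 6 (Node 0 4 6 (Node 0 2 3 Leaf (Node 0 1 6 (Node 1 4 7 (Node 0 2 4
  (Node 1 2 4 (Node 0 2 7 Leaf Leaf) Leaf) (Node 1 2 4 Leaf Leaf)) (Node 2 4 5
  (Node 1 2 4 (Node 3 4 7 Leaf Leaf) Leaf) (Node 1 2 4 Leaf (Node 0 2 4 Leaf
  Leaf)))) Leaf)) Leaf) (Node 1 4 7 (Node 0 2 3 Leaf (Node 1 2 4 (Node 0 2 4
  (Node 0 2 7 Leaf Leaf) Leaf) (Node 2 3 4 (Node 0 1 6 Leaf Leaf) Leaf)))
  (Node 2 3 4 (Node 0 2 4 Leaf (Node 0 1 6 (Node 1 2 4 Leaf Leaf) (Node 1 2 4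
  Leaf Leaf))) (Node 1 2 4 (Node 2 4 5 (Node 3 4 7 Leaf Leaf) Leaf) Leaf))))
  (Node 1 2 3 (Node 0 2 4 (Node 1 3 7 (Node 2 4 5 (Node 2 4 7 Leaf Leaf) Leaf)
  (Node 0 2 7 (Node 2 4 5 (Node 2 3 7 Leaf Leaf) Leaf) (Node 2 4 5 (Node 1 4 7
  Leaf Leaf) Leaf))) (Node 3 5 6 (Node 2 4 5 Leaf (Node 1 2 4 Leaf (Node 0 4 6
  Leaf Leaf))) (Node 1 3 6 (Node 2 4 5 Leaf (Node 1 2 4 Leaf Leaf))
  (Node 2 4 5 Leaf (Node 1 2 4 Leaf (Node 3 4 6 Leaf Leaf)))))) Leaf)))))))
  (Node 0 3 5 (Node 2 3 5 (Node 1 3 5 (Node 0 1 4 Leaf (Node 2 3 4 (Node 0 3 4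
  (Node 0 2 4 Leaf (Node 0 4 9 (Node 2 4 5 Leaf (Node 1 2 4 Leaf (Node 0 1 9
  Leaf Leaf))) (Node 2 4 5 Leaf (Node 1 2 4 Leaf (Node 2 5 9 (Node 1 2 9 Leaf
  Leaf) (Node 1 2 9 Leaf Leaf)))))) (Node 2 3 9 (Node 0 1 3 Leaf (Node 0 3 9
  (Node 1 2 4 Leaf (Node 1 2 9 Leaf (Node 0 1 9 Leaf Leaf))) Leaf))
  (Node 0 1 3 Leaf (Node 1 2 4 Leaf (Node 1 2 9 Leaf Leaf))))) (Node 1 3 4
  (Node 1 2 5 Leaf (Node 0 2 4 (Node 0 1 3 Leaf (Node 0 3 8 (Node 0 2 8 Leaf
  Leaf) (Node 0 2 8 Leaf Leaf))) Leaf)) (Node 1 2 4 (Node 0 2 4 (Node 0 2 8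
  (Node 0 3 8 Leaf Leaf) (Node 0 3 8 Leaf Leaf)) Leaf) Leaf)))) Leaf) Leaf)
  Leaf)))).

End Clauses.

(* The octahedron with poles 0, 1 and equator 2, 3, 4, 5, whose four faces at the
   pole 0 are stacked with the vertices 6, 7, 8, 9. *)
Definition stacked_edges : seq (nat * nat) := [::
  (0, 2); (0, 3); (0, 4); (0, 5); (1, 2); (1, 3); (1, 4); (1, 5);
  (2, 3); (3, 4); (4, 5); (2, 5); (0, 6); (2, 6); (3, 6); (0, 7); (3, 7); (4, 7);
  (0, 8); (4, 8); (5, 8); (0, 9); (2, 9); (5, 9)]%N.

Definition adj (i j : nat) : bool :=
  ((i, j) \in stacked_edges) || ((j, i) \in stacked_edges).

Definition wf (s : seq nat) : bool := uniq s && all (fun i => i < 10)%N s.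

(** This test and the next three collect the combinatorial hypotheses under which the clauses are
    valid, to be checked on the lists by computation. *)
Definition wf_fan (w : nat * nat * nat * nat * nat) : bool :=
  let: (t, s, p, q, r) := w in wf [:: t; s; p; q; r].

Definition wf_triangle (w : nat * nat * nat * nat) : bool :=
  let: (a, b, c, v) := w in
  [&& wf [:: a; b; c; v], adj a b, adj b c, adj c a & ~~ adj a v].

Definition wf_diamond (w : nat * nat * nat * nat) : bool :=
  let: (x, y, c, d) := w in
  [&& wf [:: x; y; c; d], adj x y, adj x c, adj y c, adj x d, adj d y & ~~ adj c d].

Definition wf_kite (w : nat * nat * nat * nat * nat) : bool :=
  let: (x, y, c, d, r) := w in
  [&& wf [:: x; y; c; d; r], adj x y, adj x c, adj y c, adj x d, adj d r & ~~ adj c d].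

Definition clauses : seq (seq lit) :=
  map (fan true) fans_left ++ map (fan false) fans_right ++
  map triangle_clause triangles ++
  map (diamond true) diamonds ++ map (diamond false) diamonds ++
  map (kite true) kites_left ++ map (kite false) kites_right.

Lemma clauses_refuted : refutes case_split clauses.
Proof. by vm_compute. Qed.

Lemma wf_clauses : [/\ all wf_fan (fans_left ++ fans_right), all wf_triangle triangles,
  all wf_diamond diamonds & all wf_kite (kites_left ++ kites_right)].
Proof. by split; vm_compute. Qed.

Lemma wf_nth s ks :
    wf s -> uniq ks && all (fun i => i < size s)%N ks ->
  wf [seq nth 0%N s k | k <- ks].
Proof.
move=> /andP[us /allP s10] /andP[uk /allP ks_s]; rewrite /wf map_inj_in_uniq ?uk /=.
  by apply/allP => _ /mapP[k /ks_s ks1 ->]; rewrite s10 ?mem_nth.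
by move=> i j /ks_s i_s /ks_s j_s /eqP; rewrite nth_uniq // => /eqP.
Qed.

Lemma adj_sym : symmetric adj.
Proof. by move=> i j; rewrite /adj orbC. Qed.

(** * Geometric validity of the clauses *)

Section Valuation.
Variables (R : realType) (p : nat -> R * R) (O : set (R * R)).
Hypothesis general : forall i j k, wf [:: i; j; k] -> det (p i) (p j) (p k) != 0.
Hypothesis block : forall i j, wf [:: i; j] -> ~~ adj i j ->
  segment (p i) (p j) `&` O !=set0.
Hypothesis out : outside adj p O.

Let ccw i j k : bool := 0 < det (p i) (p j) (p k).
Let sign (b : bool) : R := if b then 1 else -1.

Let ccw_rot i j k : ccw j k i = ccw i j k.
Proof. by rewrite /ccw det_rot. Qed.

Let ccw_swap i j k : wf [:: i; j; k] -> ccw j i k = ~~ ccw i j k.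
Proof.
by move=> /general n; rewrite /ccw det_swap oppr_gt0 -leNgt le_eqVlt (negPf n).
Qed.

(** Sorting the indices is a permutation: rotations keep the orientation and transpositions reverse
    it. *)
Let holds_turn b i j k :
  wf [:: i; j; k] -> holds ccw (turn b i j k) = (ccw i j k == b).
Proof.
move=> w.
have e1 := ccw_swap w; have e2 : ccw i k j = ~~ ccw i j k by rewrite (ccw_rot j i k).
have e3 : ccw k j i = ~~ ccw i j k by rewrite (ccw_rot i k j).
have e4 := ccw_rot i j k; have e5 : ccw k i j = ccw i j k by rewrite -(ccw_rot k i j).
have neg_eq (b1 b2 : bool) : (~~ b1 == ~~ b2) = (b1 == b2) by case: b1; case: b2.
by rewrite /turn /holds; do 3?case: ifP => _ /=; rewrite ?(e1, e2, e3, e4, e5) ?neg_eq.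
Qed.

Let ccw_sign b i j k : wf [:: i; j; k] ->
  (ccw i j k == b) = (0 < sign b * det (p i) (p j) (p k)).
Proof.
move=> /general n; rewrite /ccw /sign.
case: b; rewrite ?mul1r ?mulN1r ?oppr_gt0 ?eqb_id //.
by rewrite eqbF_neg -leNgt le_eqVlt (negPf n).
Qed.

Let ccw_signN b i j k : wf [:: i; j; k] ->
  (ccw i j k == ~~ b) = (sign b * det (p i) (p j) (p k) < 0).
Proof.
move=> w; rewrite ccw_sign // /sign.
by case: b => /=; rewrite ?mul1r ?mulN1r ?oppr_gt0 ?oppr_lt0.
Qed.

(** This and the next three forms turn the failed literals of a clause into strict signs of
    determinants. *)
Let neqN b i j k : wf [:: i; j; k] ->
  ~~ (ccw i j k == ~~ b) = (0 < sign b * det (p i) (p j) (p k)).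
Proof. by move=> /(ccw_sign b) <-; case: b; case: (ccw _ _ _). Qed.

Let neqP b i j k : wf [:: i; j; k] ->
  ~~ (ccw i j k == b) = (sign b * det (p i) (p j) (p k) < 0).
Proof. by move=> /(ccw_signN b) <-; case: b; case: (ccw _ _ _). Qed.

Let neqF i j k : wf [:: i; j; k] ->
  ~~ (ccw i j k == false) = (0 < det (p i) (p j) (p k)).
Proof. by move=> /(neqN true); rewrite /sign mul1r. Qed.

Let neqT i j k : wf [:: i; j; k] ->
  ~~ (ccw i j k == true) = (det (p i) (p j) (p k) < 0).
Proof. by move=> /(neqP true); rewrite /sign mul1r. Qed.

(** If the clause failed, then after multiplication by [sign b] the left side of [det_plucker] would
    be negative and the right side positive. *)
Let fan_holds b w : wf_fan w -> has (holds ccw) (fan b w).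
Proof.
case: w => [[[[t s] q1] q2] q3] w; rewrite /wf_fan in w.
have W ks := @wf_nth _ ks w.
have w1 := W [:: 0; 1; 2]%N isT; have w2 := W [:: 0; 1; 3]%N isT.
have w3 := W [:: 0; 1; 4]%N isT; have w4 := W [:: 0; 2; 3]%N isT.
have w5 := W [:: 0; 3; 4]%N isT; have w6 := W [:: 0; 2; 4]%N isT.
rewrite /= in w1 w2 w3 w4 w5 w6.
apply: contraT; rewrite /= !holds_turn // !negb_or.
rewrite !neqN // !neqF // neqT // => /and5P[h1 h2 h3 h4 /and3P[h5 h6 _]].
have := det_plucker (p t) (p s) (p q1) (p q2) (p q3).
move/(congr1 ( *%R (sign b))).
nra.
Qed.

Let triangle_holds w : wf_triangle w -> has (holds ccw) (triangle_clause w).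
Proof.
case: w => [[[a b] c] v] /and5P[w ab bc ca av].
have W ks := @wf_nth _ ks w.
have w1 := W [:: 0; 1; 3]%N isT; have w2 := W [:: 1; 2; 3]%N isT.
have w3 := W [:: 2; 0; 3]%N isT; rewrite /= in w1 w2 w3.
apply: contraT; rewrite /= !holds_turn // !negb_or !neqF // andbT => /and3P h.
have wav := W [:: 0; 3]%N isT.
by case: (outside_triangle out ab bc ca (block wav av)).
Qed.

Let diamond_holds b w : wf_diamond w -> has (holds ccw) (diamond b w).
Proof.
case: w => [[[x y] c] d] /and5P[w xy xc yc /and3P[xd dy cd]].
have W ks := @wf_nth _ ks w.
have w1 := W [:: 0; 1; 2]%N isT; have w2 := W [:: 0; 1; 3]%N isT.
have w3 := W [:: 2; 3; 0]%N isT; have w4 := W [:: 2; 3; 1]%N isT.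
rewrite /= in w1 w2 w3 w4.
apply: contraT; rewrite /= !holds_turn // !negb_or !neqN // !neqP // andbT.
move=> /and4P[h1 h2 h3 h4].
have wcd := W [:: 2; 3]%N isT.
by case: (outside_diamond adj_sym out xy xc yc xd dy (block wcd cd) h1 h2 h3 h4).
Qed.

Let kite_holds b w : wf_kite w -> has (holds ccw) (kite b w).
Proof.
case: w => [[[[x y] c] d] r] /and5P[w xy xc yc /and3P[xd dr cd]].
have W ks := @wf_nth _ ks w.
have w1 := W [:: 0; 1; 2]%N isT; have w2 := W [:: 0; 1; 3]%N isT.
have w3 := W [:: 2; 3; 0]%N isT; have w4 := W [:: 2; 3; 1]%N isT.
have w5 := W [:: 0; 1; 4]%N isT; have w6 := W [:: 3; 4; 0]%N isT.
have w7 := W [:: 3; 4; 1]%N isT; have w8 := W [:: 2; 3; 4]%N isT.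
rewrite /= in w1 w2 w3 w4 w5 w6 w7 w8.
apply: contraT; rewrite /= !holds_turn // !negb_or !neqN // !neqP // andbT.
move=> /and5P[h1 h2 h3 h4 /and4P[h5 h6 h7 h8]].
have wcd := W [:: 2; 3]%N isT.
by case: (outside_crossing adj_sym out xy xc yc xd dr (block wcd cd)
  h5 h6 h7 h8 h1 h2 h3 h4).
Qed.

Lemma clauses_hold : models ccw clauses.
Proof.
have [f t d k] := wf_clauses; rewrite !all_cat in f k.
case/andP: f => fl fr; case/andP: k => kl kr.
rewrite /models /clauses !all_cat !all_map; apply/and5P; split.
- by apply: sub_all fl => w; exact: fan_holds.
- by apply: sub_all fr => w; exact: fan_holds.
- by apply: sub_all t => w; exact: triangle_holds.
- by apply: sub_all d => w; exact: diamond_holds.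
apply/and3P; split.
- by apply: sub_all d => w; exact: diamond_holds.
- by apply: sub_all kl => w; exact: kite_holds.
- by apply: sub_all kr => w; exact: kite_holds.
Qed.

Lemma not_outside : False.
Proof. by have := refutesP ccw clauses_refuted; rewrite clauses_hold. Qed.

End Valuation.

(** * Obstacle number *)

Section ObstacleNumber.
Variables (R : realType) (G : sgraph).

(* For every nonedge, a one-point obstacle off the drawing. *)
Lemma finite_representation : exists k, has_obstacle_representation R G k.
Proof.
pose p (v : G) : R * R := moment R (enum_rank v).
have injp : injective p.
  by move=> u v [/eqP]; rewrite eqr_nat => /eqP/val_inj/enum_rank_inj.
have detp i j k : uniq [:: i; j; k] -> det (p i) (p j) (p k) != 0.
  move=> u; apply: det_moment.
  by have := map_inj_uniq (inj_comp val_inj enum_rank_inj) [:: i; j; k]; rewrite u.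
have det0 u v a : edge u v -> det (p u) (p v) (p a) = 0 -> a \in [:: u; v].
  move=> uv /eqP; apply: contraTT => nin; apply: detp; move: nin.
  rewrite /= !inE !negb_or !andbT (eq_sym u a) (eq_sym v a) => /andP[-> ->].
  rewrite !andbT.
  by apply: contraTneq uv => ->; rewrite edge_irrefl.
have /choice[t tP] (w : G * G) : exists t, nonedge w.1 w.2 ->
    [/\ 0 <= t, t <= 1 & ~ drawing p (lerp (p w.1) (p w.2) t)].
  have [wn|_] := boolP (nonedge w.1 w.2); last by exists 0.
  (* For an edge [e], the polynomial [f e] is the determinant of [e] with the point at time [t] on
     [a b]. It vanishes identically only if [a] and [b] are on the line of [e], which would make
     [a b] that edge. *)
  case: w wn => a b /= /andP[ab nab].
  pose f (e : G * G) : {poly R} := Poly [:: det (p e.1) (p e.2) (p a);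
    det (p e.1) (p e.2) (p b) - det (p e.1) (p e.2) (p a)].
  have f0 e : edge e.1 e.2 -> f e != 0.
    case: e => u v /= uv; apply/eqP => fe0.
    have := congr1 (fun P : {poly R} => P`_0) fe0; rewrite coef_Poly coef0 /= => fa.
    have := congr1 (fun P : {poly R} => P`_1) fe0.
    rewrite coef_Poly coef0 /= fa subr0 => fb.
    have := det0 _ _ _ uv fa; have := det0 _ _ _ uv fb; move: ab nab uv; rewrite !inE.
    by move=> ab nab uv /orP[] /eqP ? /orP[] /eqP ?; subst; rewrite ?eqxx // in ab nab;
      rewrite ?uv // edge_sym uv in nab.
  have Q0 : \prod_(e | edge e.1 e.2) f e != 0 by apply/prodf_neq0 => e; exact: f0.
  have [t [t0 t1 Qt]] := small_nonroot Q0 (@ltr01 R).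
  (* Serves to exclude that the chosen point is [p a] or [p b]; other vertices are off the line
     [a b]. *)
  have ab1 : (p a).1 != (p b).1.
    by rewrite /= eqr_nat; apply: contraNneq ab => /val_inj/enum_rank_inj ->.
  exists t => _; split; do ?exact: ltW.
  move=> [[w wE]|[u [v [uv /segmentP[s [_ _ sE]]]]]].
    have [|wab] := boolP (w \in [:: a; b]).
      rewrite !inE => /orP[] /eqP wab; move: wE; rewrite wab => /(congr1 fst) /= e;
        move: ab1; rewrite -subr_eq0 => n.
        have /eqP : t * ((p a).1 - (p b).1) = 0 by rewrite /=; lra.
        by rewrite mulf_eq0 (gt_eqF t0) (negPf n).
      have /eqP : (1 - t) * ((p a).1 - (p b).1) = 0 by rewrite /=; lra.
      by rewrite mulf_eq0 subr_eq0 (gt_eqF t1) (negPf n).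
    have /negP[] : det (p a) (p b) (p w) != 0.
      apply: detp; move: wab; rewrite /= !inE !negb_or !andbT ab /=.
      by rewrite (eq_sym a w) (eq_sym b w).
    by rewrite -wE det_lerp det_aa det_bb !mulr0 addr0.
  move: Qt; rewrite horner_prod => /prodf_neq0/(_ (u, v) uv)/negP[].
  have -> : (f (u, v)).[t] = det (p u) (p v) (lerp (p a) (p b) t).
    by rewrite horner_Poly det_lerp /=; ring.
  by rewrite sE det_lerp det_aa det_bb !mulr0 addr0.
pose c (w : G * G) := lerp (p w.1) (p w.2) (t w).
(* Obstacles are indexed by all ordered pairs; a pair that is not a nonedge gets the empty set,
   which counts as connected. *)
exists #|{: G * G}|, p, (fun i => [set z |
  nonedge (enum_val i).1 (enum_val i).2 /\ z = c (enum_val i)]).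
split=> // [i|i|a b ab].
- have [wn|nw] := boolP (nonedge (enum_val i).1 (enum_val i).2).
    by rewrite (_ : [set z | _] = [set c (enum_val i)]);
      [exact: connected1 | apply/seteqP; split=> z //= [] ].
  by move=> B [z Bz] [C _ BE]; move: Bz; rewrite BE => -[[wn _] _]; case/negP: nw.
- apply/seteqP; split=> // z [[wn ->] dz].
  by have [_ _] := tP _ wn; exact.
- have [t0 t1 _] := tP (a, b) ab; exists (enum_rank (a, b)).
  exists (c (a, b)); split; first exact: segment_lerp.
  by rewrite /= enum_rankK.
Qed.

(** Zero obstacles cannot block the nonedge [a b], and one is excluded by hypothesis. The default
    value of [xget] does not arise, because [finite_representation] provides a least number. *)
Lemma obs_gt1 (a b : G) :
  nonedge a b -> ~ has_obstacle_representation R G 1 -> (1 < obs R G)%N.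
Proof.
move=> ab no1; rewrite /obs; case: xgetP => [k _ [rep _]|none].
  case: k rep => [|[|k]] //.
  by move=> [p [obst [_ _ _ /(_ a b ab)[[]]]]].
have ex : exists k, `[< has_obstacle_representation R G k >].
  by have [k rep] := finite_representation; exists k; exact/asboolP.
exfalso; apply: (none (ex_minn ex)); case: ex_minnP => k /asboolP rep kmin.
by split=> // j rj; apply: kmin; exact/asboolP.
Qed.

End ObstacleNumber.

(** * The graph formed by two disjoint copies *)

Definition copy_edge (x y : 'I_10 + 'I_10) : bool :=
  match x, y with
  | inl i, inl j | inr i, inr j => adj i j
  | _, _ => false
  end.

Lemma copy_edge_sym : symmetric copy_edge.
Proof. by move=> [i|i] [j|j] //=; exact: adj_sym. Qed.

Lemma adj_irrefl : irreflexive adj.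
Proof.
move=> i; rewrite /adj orbb; apply/negP => ii.
by have /allP/(_ _ ii) : all (fun e => e.1 != e.2) stacked_edges by []; rewrite /= eqxx.
Qed.

Lemma copy_edge_irrefl : irreflexive copy_edge.
Proof. by move=> [i|i] /=; exact: adj_irrefl. Qed.

Definition two_copies : sgraph := SGraph copy_edge_sym copy_edge_irrefl.

Lemma adj_lt i j : adj i j -> (i < 10)%N && (j < 10)%N.
Proof.
have /allP small : all (fun e => (e.1 < 10) && (e.2 < 10))%N stacked_edges by [].
by rewrite /adj => /orP[] /small //=; rewrite andbC.
Qed.

(** The clauses use natural indices; [adj] relates only numbers below ten, on which [inord] is
    faithful. *)
Lemma outside_inord (R : realType) (p : 'I_10 -> R * R) (O : set (R * R)) :
  outside (fun i j : 'I_10 => adj i j) p O -> outside adj (fun n => p (inord n)) O.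
Proof.
move=> out A B C n AB BC CA.
have sideI X Y : side adj (fun n => p (inord n)) X Y ->
    side (fun i j : 'I_10 => adj i j) p X Y.
  move=> [u [v [uv uX uY]]]; have /andP[u10 v10] := adj_lt uv.
  by exists (inord u), (inord v); split=> //; rewrite !inordK.
by apply: out => //; exact: sideI.
Qed.

Lemma one_copy_not_outside (R : realType) (p : 'I_10 -> R * R) (O : set (R * R)) :
    (forall i j k, uniq [:: i; j; k] -> det (p i) (p j) (p k) != 0) ->
    (forall i j : 'I_10, i != j -> ~~ adj i j -> segment (p i) (p j) `&` O !=set0) ->
  ~ outside (fun i j : 'I_10 => adj i j) p O.
Proof.
have inordE (i j : nat) : (i < 10)%N -> (j < 10)%N ->
    ((inord i : 'I_10) == inord j) = (i == j).
  by move=> i10 j10; rewrite -val_eqE /= !inordK.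
move=> general block /outside_inord; apply: not_outside => [i j k|i j].
  rewrite /wf /= !inE !andbT => /andP[u /and3P[i10 j10 k10]].
  by apply: general; rewrite /= !inE !inordE // !andbT.
rewrite /wf /= !inE !andbT => /andP[ij /andP[i10 j10]] nij.
by apply: block; rewrite ?inordE ?inordK.
Qed.

Lemma not_one_obstacle (R : realType) : ~ has_obstacle_representation R two_copies 1.
Proof.
move=> [p [obst [_ cO offO block]]].
have [|q [K [general cK offK block']]] := perturb (cO ord0) (offO ord0).
  by move=> u v /block[i]; rewrite (ord1 i).
have off (u v : two_copies) : edge u v -> K `&` segment (q u) (q v) = set0.
  move=> uv; apply/seteqP; split=> // z [Oz zs]; rewrite -offK; split=> //.
  by right; exists u, v.
(* Vertices of different copies are never adjacent, so the obstacle blocks every segment between the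
   copies. *)
have [] := @outside_one R 'I_10 'I_10 (fun i j => adj i j) (fun i j => adj i j)
  (fun i => q (inl i)) (fun i => q (inr i)) K cK (fun u v => off (inl u) (inl v))
  (fun u v => off (inr u) (inr v)) (fun u v => block' (inl u) (inr v) isT) ord0.
- apply: one_copy_not_outside => [i j k u|i j ij nij].
    by apply: general; have := map_inj_uniq (@inl_inj _ 'I_10) [:: i; j; k]; rewrite u.
  by apply: block'; rewrite /nonedge nij andbT.
- apply: one_copy_not_outside => [i j k u|i j ij nij].
    by apply: general; have := map_inj_uniq (@inr_inj 'I_10 _) [:: i; j; k]; rewrite u.
  by apply: block'; rewrite /nonedge nij andbT.
Qed.

(** * Planarity *)

(** A straight-line drawing without crossings on integer points; the second ten points are the first
    ten translated by [(12, 17)]. *)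
Definition coordinates : seq (int * int) := [::
  (9, 7); (2, 6); (9, 10); (4, 6); (11, 2); (11, 12); (8, 7); (7, 5); (10, 9); (10, 10);
  (21, 24); (14, 23); (21, 27); (16, 23); (23, 19); (23, 29); (20, 24); (19, 22);
  (22, 26); (22, 27)].

Definition copies_edges : seq (nat * nat) :=
  stacked_edges ++ [seq (e.1 + 10, e.2 + 10)%N | e <- stacked_edges].

Definition idet (i j k : nat) : int :=
  det (nth 0 coordinates i) (nth 0 coordinates j) (nth 0 coordinates k).

(** The inequality is weak, so that edges with a common endpoint pass the test with product zero. *)
Definition same_side (e f : nat * nat) : bool :=
  0 <= idet e.1 e.2 f.1 * idet e.1 e.2 f.2.

Lemma coordinates_uniq : uniq coordinates.
Proof. by vm_compute. Qed.

Lemma coordinates_general : all (fun e => all (fun k =>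
  [|| k == e.1, k == e.2 | idet e.1 e.2 k != 0]) (iota 0 20)) copies_edges.
Proof. by vm_compute. Qed.

Lemma coordinates_plane : all (fun e => all (fun f =>
  [|| e == f, same_side e f | same_side f e]) copies_edges) copies_edges.
Proof. by vm_compute. Qed.

Definition code (x : 'I_10 + 'I_10) : nat :=
  match x with inl i => i | inr i => (i + 10)%N end.

Lemma code_inj : injective code.
Proof.
move=> [i|i] [j|j] /= e; have := ltn_ord i; have := ltn_ord j.
- by move=> _ _; congr inl; exact: val_inj.
- by move=> _; rewrite e ltnNge leq_addl.
- by rewrite -e ltnNge leq_addl.
- by move=> _ _; congr inr; apply/val_inj/(addIn e).
Qed.

Lemma code_lt x : (code x < 20)%N.
Proof.
by case: x => i /=; [apply: leq_trans (ltn_ord i) _ | rewrite (@ltn_add2r 10 i 10)].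
Qed.

Lemma edge_code x y : copy_edge x y ->
  ((code x, code y) \in copies_edges) || ((code y, code x) \in copies_edges).
Proof.
rewrite !mem_cat; case: x y => [i|i] [j|j] //= /orP[] ij; rewrite ?ij ?orbT //.
- by rewrite (map_f (fun e => (e.1 + 10, e.2 + 10)%N) ij) orbT.
- by rewrite (map_f (fun e => (e.1 + 10, e.2 + 10)%N) ij) !orbT.
Qed.

Section Planarity.
Variable R : realType.

Definition place (x : two_copies) : R * R :=
  ((nth 0 coordinates (code x)).1%:~R, (nth 0 coordinates (code x)).2%:~R).

Lemma det_place x y z :
  det (place x) (place y) (place z) = (idet (code x) (code y) (code z))%:~R.
Proof. by rewrite /idet /det /= !(rmorphB, rmorphM). Qed.

Lemma place_inj : injective place.
Proof.
move=> x y [/intr_inj h1 /intr_inj h2]; apply/code_inj/eqP.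
rewrite -(nth_uniq 0 _ _ coordinates_uniq) ?code_lt //.
by rewrite (surjective_pairing (nth _ _ (code x))) h1 h2 -surjective_pairing.
Qed.

Lemma lerp_inj (a b : R * R) s t : a != b -> lerp a b s = lerp a b t -> s = t.
Proof.
move=> ab [h1 h2]; apply/eqP; rewrite -subr_eq0; apply: contra_neqT ab => st.
rewrite (surjective_pairing a) (surjective_pairing b).
by congr pair; apply: (mulfI st); lra.
Qed.

Lemma place_edge (x y z : two_copies) :
  edge x y -> det (place x) (place y) (place z) = 0 -> z = x \/ z = y.
Proof.
move=> xy; rewrite det_place => /eqP; rewrite intr_eq0 => d0.
have zin : code z \in iota 0 20 by rewrite mem_iota code_lt.
have /orP[e|e] := edge_code xy;
  have /allP/(_ _ e)/allP/(_ _ zin)/or3P[/eqP/code_inj|/eqP/code_inj|/negP[]] :=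
    coordinates_general; rewrite /=; auto.
by rewrite -(intr_eq0 R) -det_place det_swap oppr_eq0 det_place intr_eq0.
Qed.

Definition beside (a b c d : R * R) : Prop := 0 <= det a b c * det a b d.

Lemma place_same_side (u v x y : two_copies) :
    same_side (code u, code v) (code x, code y) ->
  beside (place u) (place v) (place x) (place y).
Proof. by rewrite /beside !det_place -intrM ler0z. Qed.

Lemma besidel a b c d : beside b a c d -> beside a b c d.
Proof. by rewrite /beside !(det_swap a b) mulrNN. Qed.

Lemma besider a b c d : beside a b d c -> beside a b c d.
Proof. by rewrite /beside mulrC. Qed.

Lemma place_plane (u v x y : two_copies) : edge u v -> edge x y ->
    [set u; v] <> [set x; y] ->
  beside (place u) (place v) (place x) (place y) \/
  beside (place x) (place y) (place u) (place v).
Proof.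
have key (i j k l : two_copies) : (code i, code j) \in copies_edges ->
    (code k, code l) \in copies_edges -> [set i; j] <> [set k; l] ->
    beside (place i) (place j) (place k) (place l) \/
    beside (place k) (place l) (place i) (place j).
  move=> ij kl n; have /allP/(_ _ ij)/allP/(_ _ kl)/or3P[|h|h] := coordinates_plane.
  - by move=> /eqP[/code_inj e1 /code_inj e2]; case: n; rewrite e1 e2.
  - by left; exact: place_same_side.
  - by right; exact: place_same_side.
(* Each edge is listed in only one of its two directions, whence four cases. *)
move=> /edge_code/orP[] uv /edge_code/orP[] xy n.
- exact: key.
- have [|h|h] := key u v y x uv xy _; first by rewrite (setUC [set y]).
  + by left; exact: besider.
  + by right; exact: besidel.
- have [|h|h] := key v u x y uv xy _; first by rewrite (setUC [set v]).
  + by left; exact: besidel.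
  + by right; exact: besider.
- have [|h|h] := key v u y x uv xy _; first by rewrite (setUC [set v]) (setUC [set y]).
  + by left; exact/besidel/besider.
  + by right; exact/besidel/besider.
Qed.

(** Along [x y] the function [det] of the line [u v] is affine, has weakly equal signs at both ends
    and vanishes at an inner point, so it vanishes at both ends. By [place_edge] both ends then
    belong to [u v], and the two edges coincide. *)
Lemma beside_disjoint (u v x y : two_copies) s t :
    edge u v -> edge x y -> [set u; v] <> [set x; y] -> 0 < t -> t < 1 ->
    beside (place u) (place v) (place x) (place y) ->
  lerp (place u) (place v) s <> lerp (place x) (place y) t.
Proof.
move=> uv xy n t0 t1; rewrite /beside => b e.
have : det (place u) (place v) (lerp (place x) (place y) t) = 0.
  by rewrite -e det_lerp det_aa det_bb !mulr0 addr0.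
rewrite det_lerp => z0.
have [dx dy] : det (place u) (place v) (place x) = 0 /\
    det (place u) (place v) (place y) = 0.
  move: b z0; move: (det _ _ (place x)) (det _ _ (place y)) => f g b z0.
  have f0 : f = 0.
    apply/eqP; rewrite -sqrf_eq0 eq_le sqr_ge0 andbT.
    rewrite -(@pmulr_rle0 _ (1 - t)) ?subr_gt0 //.
    (* Since the combination vanishes, this reads [(1 - t) * f ^+ 2 = - t * (f * g)], which is at
       most zero. *)
    have -> : (1 - t) * f ^+ 2 = f * ((1 - t) * f + t * g) - t * (f * g) by ring.
    by rewrite z0 mulr0 sub0r oppr_le0 mulr_ge0 // ltW.
  split=> //; move/eqP: z0.
  by rewrite f0 mulr0 add0r mulf_eq0 (gt_eqF t0) => /eqP.
have nxy : x <> y by move=> xyE; move: xy; rewrite xyE edge_irrefl.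
by have [xu|xv] := place_edge uv dx; have [yu|yv] := place_edge uv dy; subst;
  rewrite // in nxy n; case: n; rewrite // setUC.
Qed.

Lemma planar_two_copies : planar R two_copies.
Proof.
have neq (u v : two_copies) : edge u v -> place u != place v.
  by apply: contraTneq => /place_inj ->; rewrite edge_irrefl.
exists place, (fun u v => lerp (place u) (place v)); split.
- exact: place_inj.
- by move=> u v _ t _; congr pair => /=; ring.
- move=> u v uv; split.
  + exact/continuous_subspaceT/continuous_lerp.
  + by move=> s t _ _; exact/lerp_inj/neq.
  + by rewrite (surjective_pairing (place u)); congr pair => /=; ring.
  + by rewrite (surjective_pairing (place v)); congr pair => /=; ring.
- move=> u v w uv t; rewrite in_itv /= => /andP[t0 t1] e.
  have : det (place u) (place v) (place w) = 0.
    by rewrite -e det_lerp det_aa det_bb !mulr0 addr0.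
  move=> /(place_edge uv)[] wE; rewrite wE in e.
    have : lerp (place u) (place v) t = lerp (place u) (place v) 0.
      by rewrite e (surjective_pairing (place u)); congr pair => /=; ring.
    by move=> /(lerp_inj (neq _ _ uv)) te; rewrite te ltxx in t0.
  have : lerp (place u) (place v) t = lerp (place u) (place v) 1.
    by rewrite e (surjective_pairing (place v)); congr pair => /=; ring.
  by move=> /(lerp_inj (neq _ _ uv)) te; rewrite te ltxx in t1.
move=> u v x y uv xy n s t; rewrite !in_itv /= => /andP[s0 s1] /andP[t0 t1] e.
have [b|b] := place_plane uv xy n.
  exact: beside_disjoint uv xy n t0 t1 b e.
exact: beside_disjoint xy uv (nesym n) s0 s1 b (esym e).
Qed.

End Planarity.

Theorem corollary4p3 (R : realType) :
  exists G : sgraph, planar R G /\ (1 < obs R G)%N.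
Proof.
exists two_copies; split; first exact: planar_two_copies.
by apply: (@obs_gt1 R two_copies (inl ord0) (inr ord0)) => //; exact: not_one_obstacle.
Qed.
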